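(* Let $G=(V,E)$ be a locally finite connected weighted graph with measure $\mu\ge\mu_0>0$, let $p\ge 2$, $q\ge 2$, $h_1,h_2:V\to\mathbb{R}$, $F:V\times\mathbb{R}^2\to\mathbb{R}$, $e_1\in L^{\frac{p}{p-1}}(V)$, $e_2\in L^{\frac{q}{q-1}}(V)$ with $e_1\not\equiv0$, $e_2\not\equiv 0$. Assume: (H1) there is a constant $h_0>0$ such that $h_i(x)\ge h_0$ for all $x\in V$, $i=1,2$; (H2) $h_i(x)\to\infty$ as $\mathrm{dist}(x,x_0)\to\infty$ for some fixed $x_0\in V$, $i=1,2$; (F0) $F(x,s,t)$ is continuously differentiable in $(s,t)\in\mathbb{R}^2$ for all $x\in V$, and there are a continuous function $a:[0,\infty)\to[0,\infty)$ and a function $b:V\to[0,\infty)$ with $b\in L^1(V)$ such that $|F_s(x,s,t)|\le a(|(s,t)|)b(x)$, $|F_t(x,s,t)|\le a(|(s,t)|)b(x)$ and $|F(x,s,t)|\le a(|(s,t)|)b(x)$ for all $x\in V$, $(s,t)\in\mathbb{R}^2$; (F1') $F(x,0,0)=0$ for all $x\in V$, and there are $f_1,f_2,g_1,g_2:V\to[0,\infty)$ with $g_1\in L^{\frac{p}{p-1}}(V)$, $g_2\in L^{\frac{q}{q-1}}(V)$, $\|f_1\|_\infty<\min\left\{\frac{h_0}{2},\frac{qh_0}{p(q-1)}\right\}$ and $\|f_2\|_\infty<h_0-\frac{p(q-1)}{q}\|f_1\|_\infty$ such that $$|F_s(x,s,t)|\le f_2(x)\left(|t|^q+|s|^{p-1}\right)+g_1(x),\qquad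 |F_t(x,s,t)|\le f_1(x)\left(|t|^{q-1}+|s|^{\frac{qp-p}{q}}\right)+g_2(x)$$ for all $x\in V$ and $(s,t)\in\mathbb{R}^2$; (F2) at least one of the following holds: (i) there are $\beta_1>1$ and $K_1:V\to\mathbb{R}$ such that $K_1(x_1)>0$ for some $x_1\in V$ with $e_1(x_1)>0$, and $F(x,s,0)\ge -K_1(x)|s|^{\beta_1}$ for all $s\in\mathbb{R}$, $x\in V$; (ii) there are $\beta_2>1$ and $K_2:V\to\mathbb{R}$ such that $K_2(x_2)>0$ for some $x_2\in V$ with $e_2(x_2)>0$, and $F(x,0,t)\ge -K_2(x)|t|^{\beta_2}$ for all $t\in\mathbb{R}$, $x\in V$. Then for each $(\lambda_1,\lambda_2)\in(0,+\infty)\times(0,+\infty)$ the system $$\begin{cases}-\Delta_p u+h_1(x)|u|^{p-2}u=F_u(x,u,v)+\lambda_1e_1(x),& x\in V,\\ -\Delta_q v+h_2(x)|v|^{q-2}v=F_v(x,u,v)+\lambda_2e_2(x),& x\in V,\end{cases}$$ has at least one nontrivial solution $(u_{\lambda\star},v_{\lambda\star})\neq(0,0)$. Furthermore, if $(u_{\lambda\star},v_{\lambda\star})=(u_{\lambda\star},0)$, then $$\|u_{\lambda\star}\|_\infty\le\mu_0^{-\frac1p}\left(\frac{\lambda_1\|e_1\|_{L^{\frac{p}{p-1}}(V)}+\|g_1\|_{L^{\frac{p}{p-1}}(V)}}{h_0-\|f_2\|_\infty}\right)^{\frac{1}{p-1}},$$ and if $(u_{\lambda\star},v_{\lambda\star})=(0,v_{\lambda\star})$,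 then $$\|v_{\lambda\star}\|_\infty\le\mu_0^{-\frac1q}\left(\frac{\lambda_2\|e_2\|_{L^{\frac{q}{q-1}}(V)}+\|g_2\|_{L^{\frac{q}{q-1}}(V)}}{h_0-\|f_1\|_\infty}\right)^{\frac{1}{q-1}}.$$
   Context: Graph setting: $G=(V,E)$ is locally finite (each vertex lies on finitely many edges) and connected; each edge $xy\in E$ has a weight $\omega_{xy}=\omega_{yx}>0$; $y\sim x$ means $xy\in E$; $\mathrm{dist}(x,y)$ is the minimal number of edges connecting $x$ and $y$; $\mu:V\to(0,\infty)$ satisfies $\mu(x)\ge\mu_0>0$ for all $x$. Write $\int_V u\,d\mu=\sum_{x\in V}u(x)\mu(x)$, $\|u\|_{L^r(V)}=(\int_V|u|^rd\mu)^{1/r}$, $\|u\|_\infty=\sup_{V}|u|$. For $u,v:V\to\mathbb{R}$: $\Gamma(u,v)(x)=\frac{1}{2\mu(x)}\sum_{y\sim x}\omega_{xy}(u(y)-u(x))(v(y)-v(x))$, $|\nabla u|(x)=\sqrt{\Gamma(u,u)(x)}$, and for $p\ge2$ (with $|\cdot|^0=1$ if $p=2$) $$\Delta_pu(x)=\frac{1}{2\mu(x)}\sum_{y\sim x}\left(|\nabla u|^{p-2}(y)+|\nabla u|^{p-2}(x)\right)\omega_{xy}(u(y)-u(x)).$$ $C_c(V)$ is the set of finitely supported functions $V\to\mathbb{R}$. $W^{1,s}(V)$ is the completion of $C_c(V)$ under $\|u\|_{W^{1,s}(V)}=(\int_V|\nabla u|^s+|u|^s\,d\mu)^{1/s}$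 (a space of functions on $V$). For $h\ge h_0>0$, $W_h^{1,s}(V)=\{u\in W^{1,s}(V):\int_Vh|u|^sd\mu<\infty\}$ with norm $\|u\|_{W_h^{1,s}(V)}=(\int_V|\nabla u|^s+h|u|^sd\mu)^{1/s}$. Let $W=W_{h_1}^{1,p}(V)\times W_{h_2}^{1,q}(V)$. A solution of the system is a pair $(u,v)\in W$ satisfying both equations at every $x\in V$; it is nontrivial if $(u,v)\ne(0,0)$. $F_u,F_v$ (also $F_s,F_t$) are the partial derivatives of $F$ in its second and third variables; $|(s,t)|$ is the Euclidean norm. *)

(* Defs.v *)
From mathcomp Require Import all_boot all_order all_algebra.
From mathcomp Require Import all_classical all_reals all_analysis.

Set Implicit Arguments.
Unset Strict Implicit.
Unset Printing Implicit Defensive.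
Import Order.TTheory GRing.Theory Num.Theory.
Import numFieldNormedType.Exports.
Local Open Scope classical_set_scope.
Local Open Scope ring_scope.

(* [weight x y] is meaningful only when [adj x y]: it is never used off the
   edges.  [V] is not assumed countable (local finiteness and connectedness
   imply it). *)
Record wgraph (R : realType) (V : choiceType) := WGraph {
  adj : rel V;
  weight : V -> V -> R;
  vmeas : V -> R;
  adj_sym : symmetric adj;
  adj_finite : forall x, finite_set [set y | adj x y];
  adj_connected : forall x y,
    exists n, `[< exists s, [/\ path adj x s, last x s = y & size s = n] >];
  weight_sym : forall x y, adj x y -> weight x y = weight y x;
  weight_gt0 : forall x y, adj x y -> 0 < weight x y;
  vmeas_gt0 : forall x, 0 < vmeas x }.

Section graph.
Context {R : realType} {V : choiceType} (G : wgraph R V).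
Implicit Types (u v f h : V -> R) (r s p : R) (x y : V).

(* The path [x :: s] has [size s] edges. *)
Definition dist x y : nat := ex_minn (adj_connected G x y).

Definition tends_to_infty h x0 : Prop :=
  forall M : R, exists N : nat, forall x, (N <= dist x x0)%N -> M <= h x.

(* [esum] is the supremum of the finite partial sums, hence the integral when
   [f] is nonnegative; it is only applied to such [f]. *)
Definition integralV f : \bar R :=
  \esum_(x in [set: V]) (f x * vmeas G x)%:E.

Definition normL r u : \bar R :=
  (integralV (fun x => `|u x| `^ r)%R `^ r^-1)%E.

Definition inL r u : Prop := (integralV (fun x => `|u x| `^ r)%R < +oo)%E.

Definition norm_sup u : \bar R := ereal_sup (range (fun x => `|u x|%:E)).

Definition Gam u v x : R :=
  (2 * vmeas G x)^-1 *
  \sum_(y \in [set y | adj G x y]) weight G x y * (u y - u x) * (v y - v x).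

Definition grad u x : R := Num.sqrt (Gam u u x).

(* [0 `^ 0 = 1], so the gradient factors are 1 when [p = 2]. *)
Definition pLaplacian p u x : R :=
  (2 * vmeas G x)^-1 *
  \sum_(y \in [set y | adj G x y])
    (grad u y `^ (p - 2) + grad u x `^ (p - 2)) * weight G x y * (u y - u x).

Definition Cc u : Prop := finite_set [set x | u x != 0].

Definition normW s u : \bar R :=
  (integralV (fun x => grad u x `^ s + `|u x| `^ s)%R `^ s^-1)%E.

(* The completion of [Cc] for [normW s], realized as a space of functions:
   when [vmeas G] is bounded below by a positive constant, a Cauchy sequence
   of [Cc] converges pointwise, and in norm to its pointwise limit. *)
Definition inW s u : Prop :=
  exists2 w : (V -> R)^nat,
    forall n, Cc (w n) &
    normW s (fun x => w n x - u x) @[n --> \oo] --> 0%E.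

Definition inWh s h u : Prop :=
  inW s u /\ (integralV (fun x => h x * `|u x| `^ s)%R < +oo)%E.

End graph.

Section nonlinearity.
Context {R : realType} {V : choiceType}.
Implicit Type F : V -> R * R -> R.

Definition Fs F (x : V) (s t : R) : R := derive1 (fun r => F x (r, t)) s.

Definition Ft F (x : V) (s t : R) : R := derive1 (fun r => F x (s, r)) t.

Definition C1 F : Prop := forall x,
  [/\ forall z : R * R, differentiable (F x) z,
      continuous (fun z : R * R => Fs F x z.1 z.2) &
      continuous (fun z : R * R => Ft F x z.1 z.2)].

Definition norm2 (s t : R) : R := Num.sqrt (s ^+ 2 + t ^+ 2).

End nonlinearity.

Definition is_solution (R : realType) (V : choiceType) (G : wgraph R V)
    (p q : R) (h1 h2 : V -> R) (F : V -> R * R -> R) (e1 e2 : V -> R)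
    (l1 l2 : R) (u v : V -> R) : Prop :=
  [/\ inWh G p h1 u,
      inWh G q h2 v,
      forall x, - pLaplacian G p u x + h1 x * `|u x| `^ (p - 2) * u x
                = Fs F x (u x) (v x) + l1 * e1 x &
      forall x, - pLaplacian G q v x + h2 x * `|v x| `^ (q - 2) * v x
                = Ft F x (u x) (v x) + l2 * e2 x].

(* Main.v *)
Require Import Defs.
From mathcomp Require Import all_boot all_order all_algebra.
From mathcomp Require Import all_classical all_reals all_analysis.
From mathcomp Require Import finmap ring lra.
Set Implicit Arguments.
Unset Strict Implicit.
Unset Printing Implicit Defensive.
Import Order.TTheory GRing.Theory Num.Theory.
Import numFieldNormedType.Exports.
Local Open Scope classical_set_scope.
Local Open Scope ring_scope.

(** Idea.  The system is the Euler-Lagrange system of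
    [energy p h1 u + energy q h2 v - int (F (., u, v) + l1 e1 u + l2 e2 v)].
    Integrating the growth conditions (F1') from the origin, first in [s] and
    then in [t], and applying Young's inequality bounds [F] from above by
    multiples of [|s|^p] and [|t|^q] that the smallness of [f1] and [f2] makes
    strictly smaller than the potential terms: the functional is coercive.
    On pairs supported in a finite set [S] it attains its minimum, the
    minimizer solves the equations at the vertices of [S], and as its value is
    at most [0] its energy is bounded independently of [S].  The equation at a
    vertex involves finitely many vertices only, so it passes to a pointwise
    cluster point of these minimizers, given by Tychonoff's theorem, and so do
    the bounds on finite partial sums of the energy.

    Since [mu >= mu0], a function of finite energy exceeds any [e > 0] only
    finitely often, so its truncation [u - max (-e) (min u e)] has finite
    support; the remainder tends to [0] in norm by dominated convergence, so
    that finite energy suffices for membership in [W^{1,p}].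

    The pair [(0, 0)] is not a solution: (F2) forces, say, [F_s (x1, 0, 0) >= 0]
    while [e1 x1 > 0].  The bounds on semi-trivial solutions come from testing
    the equation with the truncations, for which the gradient term is
    nonnegative, and from Hoelder's inequality. *)

(** * Continuity and differentiability of real powers of nonnegative functions *)

Section powR_lemmas.
Context {R : realType}.
Implicit Types (r s t : R).

(** At exponent [0] the function is the constant [1], since [0^0 = 1]. Otherwise only the point [0]
    is delicate: there [|x| < e^(1/s)] gives [|x|^s < e]. *)
Lemma continuous_norm_powR s : 0 <= s -> continuous (fun r => `|r| `^ s).
Proof.
rewrite le_eqVlt => /predU1P[<- r|s0 r].
  by under eq_fun do rewrite powRr0; exact: cst_continuous.
have [->|rn0] := eqVneq r 0; last first.
  apply: (@continuous_comp _ _ _ (@Num.norm R R) (fun x => x `^ s)).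
    exact: norm_continuous.
  apply/differentiable_continuous/derivable1_diffP/derivable_powR.
  by rewrite in_itv/= normr_gt0 rn0.
rewrite /continuous_at normr0 powR0 ?gt_eqF//.
apply/cvgrPdist_lt => e e0; near=> x.
rewrite sub0r normrN ger0_norm ?powR_ge0//.
rewrite -[ltRHS](powRr1 (ltW e0)) -(mulVf (lt0r_neq0 s0)) powRrM.
rewrite gt0_ltr_powR// ?nnegrE ?powR_ge0//.
near: x; apply/nbhs_normP; exists (e `^ s^-1); first exact: powR_gt0.
by move=> x /=; rewrite sub0r normrN.
Unshelve. all: by end_near. Qed.

Lemma continuous_powR_ge0 (T : topologicalType) (f : T -> R) s :
  (forall x, 0 <= f x) -> 0 <= s -> continuous f ->
  continuous (fun x => f x `^ s).
Proof.
move=> f0 s0 cf.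
rewrite (_ : (fun x => _) = (fun r => `|r| `^ s) \o f); last first.
  by apply/funext => x /=; rewrite ger0_norm.
by move=> x; apply: continuous_comp; [exact: cf|exact: continuous_norm_powR].
Qed.

(* At a zero of [f] the derivative of [f] vanishes and [f `^ r] is
   [f `^ (r - 1) * f]; elsewhere this is the chain rule. *)
Lemma is_derive_powR_ge0 (f : R -> R) r t (d : R) :
  (forall x, 0 <= f x) -> 1 <= r -> is_derive t (1 : R) f d ->
  is_derive t (1 : R) (fun x => f x `^ r) (r * f t `^ (r - 1) * d).
Proof.
move=> f0 r1 fd.
have [ft|ft] : f t = 0 \/ 0 < f t.
  by move: (f0 t); rewrite le_eqVlt => /predU1P[|]; [left|right].
- have d0 : d = 0.
    suff [_ <-] : is_derive t (1 : R) f 0 by have [_ ->] := fd.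
    have dft : derivable f t 1 by [].
    (* As [f t = 0] and [f] is nonnegative, the difference quotients at [t] are nonpositive on the
       left and nonnegative on the right; the derivative is the limit of both. *)
    apply: DeriveDef => //; apply/eqP; rewrite eq_le; apply/andP; split.
      rewrite ['D_1 f t]cvg_at_leftE//; apply: limr_le.
        rewrite -(cvg_at_leftE (fun h : R => h^-1 *: ((f \o shift t) _ - f t)))//.
        apply: cvg_trans dft; apply: cvg_app.
        by move=> A [e e0 Ae]; exists e => // x xe /lt_eqF/negbT; exact: Ae.
      near=> h; rewrite ft subr0; apply: mulr_le0_ge0; last exact: f0.
      by rewrite invr_le0 ltW//; near: h; exact: nbhs_left_lt.
    rewrite ['D_1 f t]cvg_at_rightE//; apply: limr_ge.
      rewrite -(cvg_at_rightE (fun h : R => h^-1 *: ((f \o shift t) _ - f t)))//.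
      apply: cvg_trans dft; apply: cvg_app.
      by move=> A [e e0 Ae]; exists e => // x xe /gt_eqF/negbT; exact: Ae.
    near=> h; rewrite ft subr0; apply: mulr_ge0; last exact: f0.
    by rewrite invr_ge0 ltW//; near: h; exact: nbhs_right_gt.
  subst d; rewrite mulr0.
  have cf : {for t, continuous f}.
    by apply/differentiable_continuous/derivable1_diffP.
  have H : (fun h : R => h^-1 *: ((fun x => f x `^ r) (h *: 1 + t) - f t `^ r))
      @ 0^' --> 0.
    have -> : (fun h : R => h^-1 *: ((fun x => f x `^ r) (h *: 1 + t) - f t `^ r))
      = (fun h : R => f (h *: 1 + t) `^ (r - 1) *
           (h^-1 *: (f (h *: 1 + t) - f t))).
      apply/funext => h; rewrite ft powR0 ?gt_eqF ?(lt_le_trans _ r1)// !subr0.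
      rewrite -[X in X `^ r]mulr1 mulr1 -(mulr_powRB1 (f0 _)) ?(lt_le_trans _ r1)//.
      by rewrite /GRing.scale/=; ring.
    rewrite -[X in _ --> X](mulr0 (f t `^ (r - 1))); apply: cvgM.
      apply: cvg_within_filter.
      have c1 : (fun h : R => h *: (1 : R) + t) @ (0 : R) --> t.
        rewrite -[X in _ --> X]add0r -[X in _ --> X + _](scale0r (1 : R)).
        by apply: cvgD; [apply: cvgZr_tmp; exact: cvg_id|exact: cvg_cst].
      rewrite (_ : (fun h : R => _) = (fun y => `|y| `^ (r - 1)) \o
        (fun h : R => f (h *: 1 + t))); last by apply/funext => h /=; rewrite ger0_norm.
      apply: (@cvg_comp _ _ _ _ _ _ (nbhs (f t))).
        exact: (cvg_comp (fun h : R => h *: (1 : R) + t) f c1 cf).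
      rewrite -[X in X `^ (r - 1)]ger0_norm//.
      by apply: continuous_norm_powR; rewrite subr_ge0.
    by have [df dE] := fd; rewrite -[X in _ --> X]dE; exact: df.
  apply: DeriveDef; first by apply/cvg_ex; exists 0.
  exact: cvg_lim H.
- exact: (is_derive1_comp (is_derive1_powR r ft) fd).
Unshelve. all: by end_near. Qed.

End powR_lemmas.

(** * Growth bounds and the inequalities of Young and Hoelder *)

Section real_inequalities.
Context {R : realType}.
Implicit Types (p r s t : R).

(* Makes [|t| `^ p] a power of a smooth nonnegative function. *)
Lemma powR_sqr_half t p : (t ^+ 2) `^ (p / 2) = `|t| `^ p.
Proof.
by rewrite -real_normK ?num_real// -powR_mulrn// -powRrM mulrC divfK ?pnatr_eq0.
Qed.

(** [|x|^p] is [(x^2)^(p/2)] with [1 <= p / 2], so the chain rule for powers of nonnegative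
    functions applies, also at [0]. The derivative has the shape of the potential term of the
    system. *)
Lemma is_derive_norm_powR p t : 2 <= p ->
  is_derive t (1 : R) (fun x => `|x| `^ p) (p * `|t| `^ (p - 2) * t).
Proof.
move=> p2; rewrite (_ : (fun x => _) = (fun x : R => (x ^+ 2) `^ (p / 2))); last first.
  by apply/funext => x; rewrite powR_sqr_half.
have p1 : 1 <= p / 2 by lra.
have d2 : is_derive t (1 : R) (fun x : R => x ^+ 2) (2 * t).
  rewrite (_ : (fun x => _) = (@id R) * id); last by apply/funext => x.
  have /is_derive_eq := is_deriveM (is_derive_id t (1 : R)) (is_derive_id t 1).
  by apply; rewrite /GRing.scale/=; ring.
have := is_derive_powR_ge0 (@sqr_ge0 R) p1 d2.
move/is_derive_eq; apply.
rewrite (_ : p / 2 - 1 = (p - 2) / 2); last by field.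
by rewrite powR_sqr_half; field.
Qed.

(** This integrates the bound on the derivative from [0] to [t] without using integrals: for
    [0 <= t], subtracting from [psi] the primitive of the bound leaves a function [chi] with
    nonpositive derivative. A negative [t] is handled by reflecting [psi]. *)
Lemma growth_bound (psi : R -> R) (A B r : R) t : 0 <= A -> 0 <= B -> 2 <= r ->
  (forall x, derivable psi x 1) ->
  (forall x, `|derive1 psi x| <= A * `|x| `^ (r - 1) + B) ->
  psi t <= psi 0 + A * (`|t| `^ r / r) + B * `|t|.
Proof.
move=> A0 B0 r2; wlog t0 : psi t / 0 <= t.
  move=> wl dpsi bpsi; have [t0|/ltW t0] := leP 0 t; first exact: wl.
  have d' x : is_derive x (1 : R) (fun y => psi (- y)) (- derive1 psi (- x)).
    have dp : is_derive (- x) (1 : R) psi (derive1 psi (- x)).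
      by split => //; rewrite derive1E.
    have := is_derive1_comp dp (is_deriveN (is_derive_id x (1 : R))).
    by move/is_derive_eq; apply; rewrite mulrN1.
  have := wl (fun y => psi (- y)) (- t); rewrite oppr_ge0 opprK oppr0 normrN.
  move=> /(_ t0); apply=> [x|x]; first by have [] := d' x.
  by rewrite derive1E; have [_ ->] := d' x; rewrite normrN -(normrN x).
move=> dpsi bpsi.
have r0 : r != 0 by rewrite gt_eqF// (lt_le_trans _ r2).
pose chi (x : R) := psi x - A * (`|x| `^ r / r) - B * x.
have dchi x : is_derive x (1 : R) chi (derive1 psi x - A * (`|x| `^ (r - 2) * x) - B).
  have dp : is_derive x (1 : R) psi (derive1 psi x).
    by split => //; rewrite derive1E.
  have dn := is_deriveZ (A / r) (is_derive_norm_powR x r2).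
  have := is_deriveB (is_deriveB dp dn) (is_deriveZ B (is_derive_id x (1 : R))).
  rewrite (_ : _ - _ - _ = chi); last first.
    apply/funext => y; rewrite /chi !fctE /GRing.scale/=.
    by congr (_ - _ - _); rewrite -[LHS]/(A / r * _); ring.
  by move/is_derive_eq; apply; rewrite /GRing.scale/=; field.
have chid x : derivable chi x 1 by have [] := dchi x.
have : chi t <= chi 0.
  apply: (@ler0_derive1_nincr _ chi 0 t) => //.
    move=> x; rewrite in_itv/= => /andP[x0 xt].
    rewrite derive1E; have [_ ->] := dchi x.
    have := le_trans (ler_norm _) (bpsi x).
    rewrite (_ : `|x| `^ (r - 2) * x = `|x| `^ (r - 1)).
      by move=> H; lra.
    rewrite gtr0_norm// mulrC (_ : r - 2 = (r - 1) - 1); last by ring.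
    by rewrite mulr_powRB1 ?(ltW x0)//; lra.
  apply: continuous_subspaceT => x.
  exact/differentiable_continuous/derivable1_diffP.
rewrite /chi normr0 powR0// (ger0_norm t0) mul0r !mulr0 !subr0 => H; lra.
Qed.

Lemma conjugate_inv p : 1 < p -> (p / (p - 1))^-1 + p^-1 = 1.
Proof. by move=> p1; field; apply/andP; split; lra. Qed.

(** Young's inequality for [a / eta] and [b * eta], where [eta] is chosen with [eta^p / p = e], so
    that [b^p] receives exactly the coefficient [e]. *)
Lemma young_eps p e : 1 < p -> 0 < e -> exists2 C, 0 <= C &
  forall a b : R, 0 <= a -> 0 <= b ->
    a * b <= e * b `^ p + C * a `^ (p / (p - 1)).
Proof.
move=> p1 e0; set p' := p / (p - 1).
have p0 : 0 < p by lra.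
have p'0 : 0 < p' by rewrite divr_gt0//; lra.
pose eta := (e * p) `^ p^-1.
have eta0 : 0 < eta by rewrite powR_gt0// mulr_gt0.
exists (eta^-1 `^ p' / p').
  by rewrite divr_ge0 ?powR_ge0// ltW.
move=> a b a0 b0.
have ae : 0 <= a / eta by rewrite divr_ge0// ltW.
have be : 0 <= b * eta by rewrite mulr_ge0// ltW.
have := conjugate_powR ae be p'0 p0 (conjugate_inv p1).
rewrite mulrACA mulVf ?gt_eqF// mulr1 => /le_trans; apply.
rewrite (powRM _ b0 (ltW eta0)) (powRM _ a0) ?invr_ge0 ?(ltW eta0)//.
rewrite {2}/eta -powRrM mulVf ?gt_eqF// powRr1 ?(mulr_ge0 (ltW e0) (ltW p0))//.
rewrite le_eqVlt; apply/orP; left; apply/eqP; field.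
by rewrite !gt_eqF.
Qed.

Lemma powR_root_inv (A r : R) : 0 < A -> 0 < r -> (A `^ r^-1)^-1 `^ r = A^-1.
Proof.
move=> A0 r0; rewrite -powR_inv1 ?powR_ge0// powRAC -(powRrM A).
by rewrite mulVf ?gt_eqF// powRr1 ?(ltW A0)// powR_inv1// ltW.
Qed.

(** After division by the two norms [X] and [Y], Young's inequality holds term by term, and its
    right-hand sides add up to [1/p' + 1/p = 1]. If one of the norms is zero, so is every term on
    the left. *)
Lemma weighted_hoelder (I : Type) (s : seq I) (m a b : I -> R) p : 1 < p ->
  (forall i, 0 <= m i) -> (forall i, 0 <= a i) -> (forall i, 0 <= b i) ->
  \sum_(i <- s) a i * b i * m i <=
  (\sum_(i <- s) a i `^ (p / (p - 1)) * m i) `^ (p / (p - 1))^-1 *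
  (\sum_(i <- s) b i `^ p * m i) `^ p^-1.
Proof.
move=> p1 m0 a0 b0; set p' := p / (p - 1).
have p0 : 0 < p by lra.
have p'0 : 0 < p' by rewrite divr_gt0//; lra.
set A := \sum_(i <- s) a i `^ p' * m i; set B := \sum_(i <- s) b i `^ p * m i.
have A0 : 0 <= A by apply: sumr_ge0 => i _; rewrite mulr_ge0 ?powR_ge0.
have B0 : 0 <= B by apply: sumr_ge0 => i _; rewrite mulr_ge0 ?powR_ge0.
(* The weights may vanish, so a zero sum of [f i ^ r * m i] does not make [f] zero; it does make
   every product [f i * m i] zero, which suffices. *)
have null (f : I -> R) r : 0 < r -> (forall i, 0 <= f i) ->
    \sum_(i <- s) f i `^ r * m i = 0 -> \sum_(i <- s) f i * m i = 0.
  move=> r0 f0; elim: s {A B A0 B0} => [|i s IH]; first by rewrite !big_nil.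
  rewrite !big_cons => /eqP; rewrite paddr_eq0 ?mulr_ge0 ?powR_ge0//; last first.
    by apply: sumr_ge0 => j _; rewrite mulr_ge0 ?powR_ge0.
  move=> /andP[+ /eqP/IH ->]; rewrite mulf_eq0 => /orP[|/eqP ->]; last first.
    by rewrite mulr0 addr0.
  by rewrite powR_eq0 => /andP[/eqP -> _]; rewrite mul0r addr0.
have null2 (f g : I -> R) : (forall i, 0 <= f i) -> (forall i, 0 <= g i) ->
    \sum_(i <- s) f i * m i = 0 -> \sum_(i <- s) f i * g i * m i = 0.
  move=> f0 g0; elim: s {A B A0 B0 null} => [|i s IH]; first by rewrite !big_nil.
  rewrite !big_cons => /eqP; rewrite paddr_eq0 ?mulr_ge0//; last first.
    by apply: sumr_ge0 => j _; rewrite mulr_ge0.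
  by move=> /andP[/eqP + /eqP/IH ->]; rewrite mulrAC => ->; rewrite mul0r addr0.
have [Az|An] := eqVneq A 0.
  by rewrite null2// ?mulr_ge0 ?powR_ge0//; exact: (null _ p').
have [Bz|Bn] := eqVneq B 0.
  under eq_bigr do rewrite (mulrC (a _)).
  by rewrite null2// ?mulr_ge0 ?powR_ge0//; exact: (null _ p).
have {}A0 : 0 < A by rewrite lt_neqAle eq_sym An.
have {}B0 : 0 < B by rewrite lt_neqAle eq_sym Bn.
set X := A `^ _; set Y := B `^ _.
have X0 : 0 < X by rewrite powR_gt0.
have Y0 : 0 < Y by rewrite powR_gt0.
have XE : X^-1 `^ p' = A^-1 by exact: powR_root_inv.
have YE : Y^-1 `^ p = B^-1 by exact: powR_root_inv.
move: X Y X0 Y0 XE YE => X Y X0 Y0 XE YE.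
have pp := conjugate_inv p1; rewrite -/p' in pp.
have XY0 : 0 < X * Y by rewrite mulr_gt0.
rewrite -[leRHS]mulr1 -ler_pdivrMl// big_distrr/= -[leRHS]pp.
have -> : p'^-1 + p^-1 =
    \sum_(i <- s) ((a i `^ p' * m i) / A / p' + (b i `^ p * m i) / B / p).
  by rewrite big_split/= -!mulr_suml -/A -/B !divff// !mul1r.
apply: ler_sum => i _.
have ax : 0 <= a i / X by rewrite divr_ge0// ltW.
have bx : 0 <= b i / Y by rewrite divr_ge0// ltW.
have := conjugate_powR ax bx p'0 p0 pp.
rewrite (powRM _ (a0 i)) ?invr_ge0 ?(ltW X0)// (powRM _ (b0 i)) ?invr_ge0 ?(ltW Y0)//.
rewrite XE YE => /(ler_wpM2r (m0 i)).
have -> : a i / X * (b i / Y) * m i = (X * Y)^-1 * (a i * b i * m i).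
  by rewrite invfM; ring.
move=> /le_trans; apply; rewrite le_eqVlt; apply/orP; left; apply/eqP.
by move: (a i `^ p') (b i `^ p) A^-1 B^-1 p'^-1 p^-1 => *; ring.
Qed.

Lemma ler_sum_fset (I : choiceType) (A B : {fset I}) (f : I -> R) :
  (A `<=` B)%fset -> (forall i, 0 <= f i) ->
  \sum_(i <- A) f i <= \sum_(i <- B) f i.
Proof.
move=> AB f0; rewrite [leRHS](big_fsetID _ (mem A))/=.
rewrite (_ : [fset i in B | i \in A]%fset = A).
  by rewrite lerDl sumr_ge0.
apply/fsetP => i; rewrite !inE/=; apply: andb_idl; exact: (fsubsetP AB).
Qed.

End real_inequalities.

(** * Calculus on the graph: summation by parts and the first variation of the energy *)

Section graph_calculus.
Context {R : realType} {V : choiceType} (G : wgraph R V).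
Implicit Types (u v w g h : V -> R) (x y z : V) (S T : {fset V}) (p t : R).
Local Notation mu := (vmeas G).

Definition nbrs x : {fset V} := fset_set [set y | adj G x y].

(** Contains every vertex at which a function supported in [S] can have a nonzero gradient. *)
Definition closed_nbhd S : {fset V} := (S `|` \bigcup_(x <- S) nbrs x)%fset.

Lemma in_nbrs x y : (y \in nbrs x) = adj G x y.
Proof.
rewrite in_fset_set; last exact: adj_finite.
by apply/idP/idP => [/set_mem|H]; last exact: mem_set.
Qed.

Lemma closed_nbhd_sub S : {subset S <= closed_nbhd S}.
Proof. by move=> x xS; rewrite in_fsetU xS. Qed.

Lemma closed_nbhd_adj S x y : x \in S -> adj G x y -> y \in closed_nbhd S.
Proof.
move=> xS xy; rewrite in_fsetU; apply/orP; right; apply/bigfcupP.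
by exists x; rewrite ?xS// in_nbrs.
Qed.

Lemma sum_adjE (f : V -> R) x :
  \sum_(y \in [set y | adj G x y]) f y = \sum_(y <- nbrs x) f y.
Proof. by rewrite fsbig_finite//; exact: adj_finite. Qed.

(** Writing the neighbour sum over a set that does not depend on [x] allows double sums over edges
    to be exchanged. *)
Lemma sum_adj (f : V -> R) x S :
  (forall y, adj G x y -> y \notin S -> f y = 0) ->
  \sum_(y \in [set y | adj G x y]) f y =
  \sum_(y <- S) (if adj G x y then f y else 0).
Proof.
move=> f0; rewrite sum_adjE.
rewrite -(@big_fset_incl _ _ _ _ (nbrs x `&` S)%fset); first last.
- move=> y; rewrite in_fsetI in_nbrs => xy; rewrite xy/= => yS.
  exact: f0.
- exact: fsubsetIl.
rewrite -[RHS](@big_fset_incl _ _ _ _ (nbrs x `&` S)%fset); first last.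
- move=> y yS; rewrite in_fsetI in_nbrs yS andbT => /negbTE ->//.
- exact: fsubsetIr.
rewrite !big_seq; apply: eq_bigr => y.
by rewrite in_fsetI in_nbrs => /andP[-> _].
Qed.

Lemma eq_sum_adj (f g : V -> R) x : (forall y, adj G x y -> f y = g y) ->
  \sum_(y \in [set y | adj G x y]) f y = \sum_(y \in [set y | adj G x y]) g y.
Proof.
move=> fg; rewrite !sum_adjE !big_seq; apply: eq_bigr => y.
by rewrite in_nbrs => /fg.
Qed.

Lemma Gam_ge0 u x : 0 <= Gam G u u x.
Proof.
rewrite /Gam mulr_ge0//.
  by rewrite invr_ge0 mulr_ge0// ltW// vmeas_gt0.
rewrite sum_adjE big_seq sumr_ge0// => y; rewrite in_nbrs => xy.
by rewrite -mulrA -expr2 mulr_ge0 ?sqr_ge0// ltW// weight_gt0.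
Qed.

(** Removes the square root, which is not differentiable at [0]: [Gam] is polynomial in the values
    of [u]. *)
Lemma grad_powR u x r : grad G u x `^ r = Gam G u u x `^ (r / 2).
Proof. by rewrite /grad -powR12_sqrt ?Gam_ge0// -powRrM mulrC. Qed.

(** Serves for truncations: composing with a 1-Lipschitz map does not increase the gradient. *)
Lemma Gam_mono u v x :
  (forall y, `|u y - u x| <= `|v y - v x|) -> Gam G u u x <= Gam G v v x.
Proof.
move=> uv; rewrite /Gam ler_wpM2l//.
  by rewrite invr_ge0 mulr_ge0// ltW// vmeas_gt0.
rewrite !sum_adjE !big_seq ler_sum// => y; rewrite in_nbrs => xy.
rewrite -!mulrA ler_wpM2l//; first by rewrite ltW// weight_gt0.
by rewrite -!expr2 -real_normK ?num_real// -[leRHS]real_normK ?num_real// ler_sqr ?nnegrE.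
Qed.

Lemma GamDr u v w t x :
  Gam G u (fun y => v y + t * w y) x = Gam G u v x + t * Gam G u w x.
Proof.
rewrite /Gam !sum_adjE mulrCA -mulrDr; congr (_ * _).
by rewrite big_distrr -big_split/=; apply: eq_bigr => y _; ring.
Qed.

Lemma GamC u v x : Gam G u v x = Gam G v u x.
Proof.
by rewrite /Gam; congr (_ * _); apply: eq_sum_adj => y _; rewrite mulrAC.
Qed.

(** By bilinearity and symmetry the function is a quadratic polynomial in [s]. *)
Lemma is_derive_Gam u w z t :
  is_derive t (1 : R)
    (fun s => Gam G (fun x => u x + s * w x) (fun x => u x + s * w x) z)
    (2 * Gam G (fun x => u x + t * w x) w z).
Proof.
rewrite (_ : (fun s => _) =
    cst (Gam G u u z) + ((2 * Gam G u w z) *: @id R +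
      Gam G w w z *: (@id R * @id R))); last first.
  apply/funext => s; rewrite !fctE GamDr GamC GamDr GamC [X in _ + s * X]GamC GamDr.
  by rewrite (GamC w u) /GRing.scale/=; ring.
have di := is_derive_id t (1 : R).
have := is_deriveD (is_derive_cst (Gam G u u z) t 1)
  (is_deriveD (is_deriveZ (2 * Gam G u w z) di)
              (is_deriveZ (Gam G w w z) (is_deriveM di di))).
move/is_derive_eq; apply.
by rewrite [in RHS]GamC GamDr (GamC w u) /GRing.scale/=; ring.
Qed.

Lemma is_derive_sumr (I : Type) (s : seq I) (f : I -> R -> R) (d : I -> R) t :
  (forall i, is_derive t (1 : R) (f i) (d i)) ->
  is_derive t (1 : R) (fun r => \sum_(i <- s) f i r) (\sum_(i <- s) d i).
Proof.
move=> fd; elim: s => [|i s IH].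
  rewrite big_nil (_ : (fun r => _) = cst 0); first exact: is_derive_cst.
  by apply/funext => r; rewrite big_nil.
rewrite big_cons (_ : (fun r => _) = f i + (fun r => \sum_(j <- s) f j r)).
  exact: is_deriveD.
by apply/funext => r; rewrite big_cons.
Qed.

(** Both sides are half of a double sum over edges inside [closed_nbhd S], and exchanging the
    endpoints of each edge symmetrizes the factor [g]. For [g] the power [p - 2] of the gradient of
    [u], the right-hand side contains the [p]-Laplacian of [u]. *)
Lemma sum_by_parts g u w S : (forall x, x \notin S -> w x = 0) ->
  \sum_(z <- closed_nbhd S) mu z * (g z * Gam G u w z) =
  - \sum_(z <- S) mu z * w z * ((2 * mu z)^-1 *
      \sum_(y \in [set y | adj G z y]) (g y + g z) * weight G z y * (u y - u z)).
Proof.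
move=> wS; set T := closed_nbhd S.
(* The weight is symmetric on edges only; its extension by [0] is symmetric on all pairs. *)
pose c z y : R := if adj G z y then weight G z y else 0.
have cC z y : c z y = c y z.
  by rewrite /c adj_sym; case: ifP => // /weight_sym.
have muN0 z : mu z != 0 by rewrite gt_eqF// vmeas_gt0.
have -> : \sum_(z <- T) mu z * (g z * Gam G u w z) =
    2^-1 * \sum_(z <- T) \sum_(y <- T) g z * c z y * (u y - u z) * (w y - w z).
  rewrite big_distrr/= !big_seq; apply: eq_bigr => z zT; rewrite /Gam.
  (* A neighbour [y] of [z] outside [T] forces both [y] and [z] to lie outside [S], so the
     difference of [w] along this edge is [0]. *)
  rewrite (@sum_adj _ z T); last first.
    move=> y zy yT; have -> : w y = 0.
      by apply: wS; apply: contra yT; exact: closed_nbhd_sub.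
    have -> : w z = 0.
      by apply: wS; apply: contra yT => zS; exact: closed_nbhd_adj zy.
    by rewrite subrr mulr0.
  rewrite (_ : \sum_(y <- T) _ =
    \sum_(y <- T) c z y * (u y - u z) * (w y - w z)); last first.
    by apply: eq_bigr => y _; rewrite /c; case: ifP => // _; rewrite !mul0r.
  rewrite (_ : \sum_(y <- T) g z * c z y * (u y - u z) * (w y - w z) =
    g z * \sum_(y <- T) c z y * (u y - u z) * (w y - w z)); last first.
    by rewrite big_distrr; apply: eq_bigr => y _ /=; rewrite !mulrA.
  by field; rewrite muN0.
have -> : \sum_(z <- S) mu z * w z * ((2 * mu z)^-1 *
      \sum_(y \in [set y | adj G z y]) (g y + g z) * weight G z y * (u y - u z)) =
    2^-1 * \sum_(z <- T) \sum_(y <- T) w z * (g y + g z) * c z y * (u y - u z).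
  rewrite -(@big_fset_incl _ _ _ _ S _ (fun z => \sum_(y <- T) _)); first last.
  - by move=> z _ zS; rewrite big1// => y _; rewrite wS// !mul0r.
  - exact/fsubsetP/closed_nbhd_sub.
  rewrite big_distrr/= !big_seq; apply: eq_bigr => z zS.
  rewrite (@sum_adj _ z T); last first.
    by move=> y zy /negP[]; exact: closed_nbhd_adj zy.
  rewrite (_ : \sum_(y <- T) w z * (g y + g z) * c z y * (u y - u z) =
    w z * \sum_(y <- T)
      (if adj G z y then (g y + g z) * weight G z y * (u y - u z) else 0)).
    by field; rewrite muN0.
  rewrite big_distrr/=; apply: eq_bigr => y _; rewrite /c.
  by case: ifP => _; rewrite ?mulr0 ?mul0r// !mulrA.
rewrite -mulrN; congr (_ * _).
transitivity (\sum_(z <- T) \sum_(y <- T) g z * c z y * (u y - u z) * w y -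
  \sum_(z <- T) \sum_(y <- T) g z * c z y * (u y - u z) * w z).
  rewrite -sumrB; apply: eq_bigr => z _; rewrite -sumrB; apply: eq_bigr => y _.
  by rewrite mulrBr.
(* Exchanging [z] and [y] in the first sum replaces [g z] by [g y] and reverses the difference of
   [u], whence the factor [g y + g z] and the sign. *)
rewrite [X in X - _]exchange_big/= -sumrB -sumrN; apply: eq_bigr => z _.
rewrite -sumrB -sumrN; apply: eq_bigr => y _.
by rewrite (cC y z); ring.
Qed.

(** The gradient part runs over [closed_nbhd S] because the gradient of a function supported in [S]
    reaches one edge beyond [S]; with these boundary terms the first variation is the full
    [p]-Laplacian at every vertex of [S]. *)
Definition energy p h S u : R :=
  \sum_(z <- closed_nbhd S) mu z * (Gam G u u z `^ (p / 2) / p) +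
  \sum_(z <- S) mu z * (h z * `|u z| `^ p / p).

(** The derivative of [Gam^(p/2) / p] is the power [p - 2] of the gradient times [Gam] of the
    function and the direction; [sum_by_parts] turns its sum into the [p]-Laplacian tested with
    [w]. *)
Lemma is_derive_energy p h S u w t : 2 <= p -> (forall x, x \notin S -> w x = 0) ->
  is_derive t (1 : R) (fun s => energy p h S (fun x => u x + s * w x))
  (\sum_(z <- S) mu z * w z *
     (- pLaplacian G p (fun x => u x + t * w x) z +
      h z * `|u z + t * w z| `^ (p - 2) * (u z + t * w z))).
Proof.
move=> p2 wS; set ut := fun x => u x + t * w x.
have pn0 : p != 0 by rewrite gt_eqF// (lt_le_trans _ p2).
have p21 : 1 <= p / 2 by lra.
have d1 : is_derive t (1 : R)
    (fun s => \sum_(z <- closed_nbhd S) mu z *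
      (Gam G (fun x => u x + s * w x) (fun x => u x + s * w x) z `^ (p / 2) / p))
    (\sum_(z <- closed_nbhd S) mu z * (grad G ut z `^ (p - 2) * Gam G ut w z)).
  apply: is_derive_sumr => z.
  have := is_deriveZ (mu z / p) (is_derive_powR_ge0
    (fun s => Gam_ge0 (fun x => u x + s * w x) z) p21 (is_derive_Gam u w z t)).
  rewrite (_ : _ \*: _ = (fun s => mu z *
      (Gam G (fun x => u x + s * w x) (fun x => u x + s * w x) z `^ (p / 2) / p))).
    move/is_derive_eq; apply; rewrite grad_powR -/ut.
    rewrite (_ : p / 2 - 1 = (p - 2) / 2); last by field.
    rewrite -[LHS]/(mu z / p * _); move: (_ `^ _) (Gam G ut w z) => a b.
    by field.
  apply/funext => s; rewrite -[LHS]/(mu z / p * _); move: (_ `^ _) => a.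
  by field.
have d2 : is_derive t (1 : R)
    (fun s => \sum_(z <- S) mu z * (h z * `|u z + s * w z| `^ p / p))
    (\sum_(z <- S) mu z * w z * (h z * `|ut z| `^ (p - 2) * ut z)).
  apply: is_derive_sumr => z.
  have da : is_derive t (1 : R) (fun s : R => u z + s * w z) (w z).
    have := is_deriveD (is_derive_cst (u z) t 1)
      (is_deriveZ (w z) (is_derive_id t (1 : R))).
    rewrite (_ : _ + _ = (fun s : R => u z + s * w z)).
      move/is_derive_eq; apply; rewrite add0r.
      by rewrite -[LHS]/(w z * 1) mulr1.
    by apply/funext => s; rewrite -[LHS]/(u z + w z * s) mulrC.
  have := is_deriveZ (mu z * h z / p) (@is_derive1_comp _ _
    (fun s : R => u z + s * w z) t _ _ (is_derive_norm_powR (ut z) p2) da).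
  rewrite (_ : _ \*: _ = (fun s => mu z * (h z * `|u z + s * w z| `^ p / p))).
    move/is_derive_eq; apply.
    rewrite -[LHS]/(mu z * h z / p * _); rewrite /ut; move: (_ `^ _) => a.
    by field.
  apply/funext => s; rewrite -[LHS]/(mu z * h z / p * _) /=; move: (_ `^ _) => a.
  by field.
have := is_deriveD d1 d2.
rewrite -[X in is_derive _ _ X _]/(fun s => energy p h S (fun x => u x + s * w x)).
move/is_derive_eq; apply; rewrite /= sum_by_parts// -sumrN -big_split/=.
by apply: eq_bigr => z _; rewrite /pLaplacian [RHS]mulrDr mulrN.
Qed.

End graph_calculus.

(** * Coercivity of the zero-order part of the functional *)

Section coercivity.
Context {R : realType} {V : choiceType}.
Implicit Types (x : V) (s t : R).
Variables (p q : R) (F : V -> R * R -> R) (f1 f2 g1 g2 : V -> R) (m1 m2 : R).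
Hypotheses (p2 : 2 <= p) (q2 : 2 <= q).
Hypothesis F_diff : forall x z, differentiable (F x) z.
Hypothesis F00 : forall x, F x (0, 0) = 0.
Hypothesis f1m : forall x, 0 <= f1 x <= m1.
Hypothesis f2m : forall x, 0 <= f2 x <= m2.
Hypothesis g1_ge0 : forall x, 0 <= g1 x.
Hypothesis g2_ge0 : forall x, 0 <= g2 x.
Hypothesis Fs_bound : forall x s t,
  `|Fs F x s t| <= f2 x * (`|t| `^ q + `|s| `^ (p - 1)) + g1 x.
Hypothesis Ft_bound : forall x s t,
  `|Ft F x s t| <=
    f1 x * (`|t| `^ (q - 1) + `|s| `^ ((q * p - p) / q)) + g2 x.

Lemma derivable_Fl x t s : derivable (fun r => F x (r, t)) s 1.
Proof.
apply/derivable1_diffP.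
apply: (@differentiable_comp _ _ _ _ (fun r : R => (r, t)) (F x)) => //.
Qed.

Lemma derivable_Fr x s t : derivable (fun r => F x (s, r)) t 1.
Proof.
apply/derivable1_diffP.
apply: (@differentiable_comp _ _ _ _ (fun r : R => (s, r)) (F x)) => //.
Qed.

(** [growth_bound] is applied from [(0, 0)] to [(s, 0)], where the term [|t|^q] vanishes, and then
    from [(s, 0)] to [(s, t)]. Young's inequality with exponents [q / (q - 1)] and [q] splits the
    mixed term, as [(q * p - p) / q] times [q / (q - 1)] is [p]. *)
Lemma F_upper_bound x s t :
  F x (s, t) <= (m2 / p + (q - 1) / q * m1) * `|s| `^ p
    + 2 * m1 / q * `|t| `^ q + g1 x * `|s| + g2 x * `|t|.
Proof.
have /andP[f1x_ge0 f1x] := f1m x; have /andP[f2x_ge0 f2x] := f2m x.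
have p0 : 0 < p by rewrite (lt_le_trans _ p2)// ltr1n.
have q0 : 0 < q by rewrite (lt_le_trans _ q2)// ltr1n.
have m1_ge0 : 0 <= m1 by exact: le_trans f1x.
have m2_ge0 : 0 <= m2 by exact: le_trans f2x.
have B1 : F x (s, 0) <= F x (0, 0) + m2 * (`|s| `^ p / p) + g1 x * `|s|.
  apply: (growth_bound (psi := fun r => F x (r, 0))) => // r.
    exact: derivable_Fl.
  apply: le_trans (Fs_bound x r 0) _.
  rewrite normr0 powR0 ?gt_eqF// add0r lerD2r.
  by rewrite ler_wpM2r ?powR_ge0.
have B2 : F x (s, t) <= F x (s, 0) + m1 * (`|t| `^ q / q) +
    (m1 * `|s| `^ ((q * p - p) / q) + g2 x) * `|t|.
  apply: (growth_bound (psi := fun r => F x (s, r))) => //.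
  - by rewrite addr_ge0// mulr_ge0// powR_ge0.
  - by move=> r; exact: derivable_Fr.
  - move=> r; apply: le_trans (Ft_bound x s r) _.
    by rewrite addrA lerD2r -mulrDr ler_wpM2r// addr_ge0// powR_ge0.
have q1 : 1 < q by rewrite (lt_le_trans _ q2)// ltr1n.
have q'0 : 0 < q / (q - 1) by rewrite divr_gt0//; lra.
have := conjugate_powR (powR_ge0 `|s| ((q * p - p) / q)) (normr_ge0 t) q'0 q0
  (conjugate_inv q1).
rewrite -powRrM (_ : (q * p - p) / q * (q / (q - 1)) = p); last first.
  by field; rewrite !gt_eqF// subr_gt0.
move: B1 B2; rewrite F00.
move: (`|s| `^ ((q * p - p) / q)) (`|s| `^ p) (`|t| `^ q) => X P Q B1 B2 Y.
have {}Y : m1 * (X * `|t|) <= m1 * (P / (q / (q - 1)) + Q / q).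
  by rewrite ler_wpM2l.
have -> : (m2 / p + (q - 1) / q * m1) * P + 2 * m1 / q * Q + g1 x * `|s| + g2 x * `|t|
  = m2 * (P / p) + g1 x * `|s| + m1 * (Q / q) +
    m1 * (P / (q / (q - 1)) + Q / q) + g2 x * `|t|.
  by field; rewrite !gt_eqF// subr_gt0.
lra.
Qed.

Variables (h0 l1 l2 : R) (h1 h2 e1 e2 : V -> R).
Hypothesis h0_gt0 : 0 < h0.
Hypothesis h1_ge : forall x, h0 <= h1 x.
Hypothesis h2_ge : forall x, h0 <= h2 x.
Hypothesis m1_lt : m1 < h0 / 2.
Hypothesis m2_lt : m2 < h0 - p * (q - 1) / q * m1.
Hypotheses (l1_gt0 : 0 < l1) (l2_gt0 : 0 < l2).

(** The integrand of the functional without its gradient terms. *)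
Definition potential x s t : R := h1 x * `|s| `^ p / p + h2 x * `|t| `^ q / q
  - F x (s, t) - l1 * e1 x * s - l2 * e2 x * t.

(** The gap between [1 / r] and [A / h0] is at least [2 * c]: one [c] is kept for coercivity, the
    other leaves [c * h0 * P] to absorb the linear terms. *)
Let coercive1 (r c A h P : R) : 0 < r -> 0 < c -> 0 <= A ->
  A <= h0 * (r^-1 - 2 * c) -> h0 <= h -> 0 <= P ->
  c * (h * P) <= h * P / r - A * P - c * h0 * P.
Proof.
move=> r0 c0 A0 Ac hh P0.
have k0 : 0 <= r^-1 - 2 * c.
  by rewrite -(pmulr_rge0 _ h0_gt0); apply: le_trans Ac.
have -> : h * P / r - A * P - c * h0 * P = (h * r^-1 - A - c * h0) * P by ring.
rewrite mulrA ler_wpM2r//.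
have H1 : h0 * (r^-1 - 2 * c) <= h * (r^-1 - 2 * c) by rewrite ler_wpM2r.
have H2 : c * h0 <= c * h by rewrite ler_pM2l.
lra.
Qed.

(** The assumptions on [m1] and [m2] say that the coefficients [A1] and [A2] of [F_upper_bound] lie
    strictly below [h0 / p] and [h0 / q]; [c] is half the smaller of the two relative gaps. The
    linear terms go into these gaps by Young's inequality, at the cost of powers of the data. *)
Lemma potential_coercive : exists c C, [/\ 0 < c, 0 <= C & forall x s t,
  c * (h1 x * `|s| `^ p + h2 x * `|t| `^ q) <= potential x s t +
    C * (`|e1 x| `^ (p / (p - 1)) + `|g1 x| `^ (p / (p - 1)) +
         `|e2 x| `^ (q / (q - 1)) + `|g2 x| `^ (q / (q - 1)))].
Proof.
(* A vertex is used to see that [m1] and [m2] are nonnegative; on an empty [V] the claim is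
   vacuous. *)
have [[x _]|VN] := pselect (exists x : V, True); last first.
  by exists 1, 0; split=> // x; case: VN; exists x.
have p0 : 0 < p by rewrite (lt_le_trans _ p2)// ltr1n.
have q0 : 0 < q by rewrite (lt_le_trans _ q2)// ltr1n.
have m1_ge0 : 0 <= m1 by have /andP[/le_trans] := f1m x; apply.
have m2_ge0 : 0 <= m2 by have /andP[/le_trans] := f2m x; apply.
pose A1 := m2 / p + (q - 1) / q * m1.
pose A2 := 2 * m1 / q.
have A1_ge0 : 0 <= A1.
  apply: addr_ge0; first exact: divr_ge0 (ltW p0).
  apply: mulr_ge0 => //; apply: divr_ge0; last exact: ltW.
  by rewrite subr_ge0 (le_trans _ q2)// ler1n.
have A2_ge0 : 0 <= A2 by rewrite divr_ge0 ?mulr_ge0// ltW.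
have A1_lt : A1 < h0 / p.
  rewrite ltr_pdivlMr//.
  have -> : A1 * p = m2 + p * (q - 1) / q * m1 by rewrite /A1; field; rewrite !gt_eqF.
  by move: m2_lt; lra.
have A2_lt : A2 < h0 / q.
  by rewrite /A2 ltr_pM2r ?invr_gt0//; move: m1_lt; lra.
pose c := Num.min (p^-1 - A1 / h0) (q^-1 - A2 / h0) / 2.
have c0 : 0 < c.
  rewrite divr_gt0// lt_min !subr_gt0 (ltr_pdivrMr _ A1)// (ltr_pdivrMr _ A2)//.
  by rewrite (mulrC p^-1) (mulrC q^-1) A1_lt A2_lt.
have cA1 : A1 <= h0 * (p^-1 - 2 * c).
  rewrite mulrC -ler_pdivrMr// lerBrDr -lerBrDl /c mulrC divfK//.
  by rewrite ge_min lexx.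
have cA2 : A2 <= h0 * (q^-1 - 2 * c).
  rewrite mulrC -ler_pdivrMr// lerBrDr -lerBrDl /c mulrC divfK//.
  by rewrite ge_min lexx orbT.
(* Each of the two powers absorbs two linear terms, one from [g] and one from [e], so each term gets
   half of [c * h0]. *)
have eps0 : 0 < c * h0 / 2 by rewrite divr_gt0// mulr_gt0.
have p1 : 1 < p by rewrite (lt_le_trans _ p2)// ltr1n.
have q1 : 1 < q by rewrite (lt_le_trans _ q2)// ltr1n.
have [C1 C1_ge0 Y1] := young_eps p1 eps0.
have [C2 C2_ge0 Y2] := young_eps q1 eps0.
(* The division by [l1] offsets the factor [l1] in front of [e1]; likewise for [l2]. *)
have [C3 C3_ge0 Y3] := young_eps p1 (divr_gt0 eps0 l1_gt0).
have [C4 C4_ge0 Y4] := young_eps q1 (divr_gt0 eps0 l2_gt0).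
have lC3 : 0 <= l1 * C3 by rewrite mulr_ge0// ltW.
have lC4 : 0 <= l2 * C4 by rewrite mulr_ge0// ltW.
exists c, (C1 + C2 + l1 * C3 + l2 * C4).
split=> //; first by rewrite !addr_ge0.
move=> {}x s t; set P := `|s| `^ p; set Q := `|t| `^ q.
have P0 : 0 <= P by exact: powR_ge0.
have Q0 : 0 <= Q by exact: powR_ge0.
have K1 := coercive1 p0 c0 A1_ge0 cA1 (h1_ge x) P0.
have K2 := coercive1 q0 c0 A2_ge0 cA2 (h2_ge x) Q0.
have FB := F_upper_bound x s t.
have L1 : l1 * e1 x * s <= l1 * (`|e1 x| * `|s|).
  by rewrite -mulrA ler_pM2l// -normrM ler_norm.
have L2 : l2 * e2 x * t <= l2 * (`|e2 x| * `|t|).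
  by rewrite -mulrA ler_pM2l// -normrM ler_norm.
have Y1' := Y1 _ _ (normr_ge0 (g1 x)) (normr_ge0 s).
have Y2' := Y2 _ _ (normr_ge0 (g2 x)) (normr_ge0 t).
have := Y3 _ _ (normr_ge0 (e1 x)) (normr_ge0 s).
move=> /(ler_wpM2l (ltW l1_gt0)); rewrite [leRHS]mulrDr -/P => Y3'.
have := Y4 _ _ (normr_ge0 (e2 x)) (normr_ge0 t).
move=> /(ler_wpM2l (ltW l2_gt0)); rewrite [leRHS]mulrDr -/Q => Y4'.
move: FB; rewrite -/P -/Q -/A1 -/A2 /potential -/P -/Q => FB.
rewrite (_ : l1 * (c * h0 / 2 / l1 * P) = c * h0 / 2 * P) in Y3'; last first.
  by field; rewrite gt_eqF.
rewrite (_ : l2 * (c * h0 / 2 / l2 * Q) = c * h0 / 2 * Q) in Y4'; last first.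
  by field; rewrite gt_eqF.
move: Y1' Y2' Y3' Y4'; rewrite -/P -/Q.
set E1 := `|e1 x| `^ _; set E2 := `|e2 x| `^ _.
set G1 := `|g1 x| `^ _; set G2 := `|g2 x| `^ _.
have E1_ge0 : 0 <= E1 by exact: powR_ge0.
have E2_ge0 : 0 <= E2 by exact: powR_ge0.
have G1_ge0 : 0 <= G1 by exact: powR_ge0.
have G2_ge0 : 0 <= G2 by exact: powR_ge0.
rewrite (ger0_norm (g1_ge0 x)) (ger0_norm (g2_ge0 x)).
move: E1 E2 G1 G2 E1_ge0 E2_ge0 G1_ge0 G2_ge0 => E1 E2 G1 G2 E10 E20 G10 G20.
move=> Y1' Y2' Y3' Y4'.
pose D := l1 * C3 * E1 + l2 * C4 * E2 + C1 * G1 + C2 * G2.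
have DC : D <= (C1 + C2 + l1 * C3 + l2 * C4) * (E1 + G1 + E2 + G2).
  move: (l1 * C3) (l2 * C4) lC3 lC4 @D => a b a0 b0.
  by rewrite /=; nra.
apply: (@le_trans _ _ (h1 x * P / p + h2 x * Q / q - F x (s, t) - l1 * e1 x * s -
  l2 * e2 x * t + D)); last by rewrite lerD2l.
rewrite /D; clear DC D.
rewrite (mulrA l1 C3) in Y3'; rewrite (mulrA l2 C4) in Y4'.
move: (l1 * C3 * E1) (l2 * C4 * E2) (C1 * G1) (C2 * G2) Y1' Y2' Y3' Y4' => a1 a2 a3 a4 *.
lra.
Qed.

End coercivity.

(** * Continuity of the vertexwise operators when every vertex value is continuous *)

Section continuity.
Context {R : realType} {V : choiceType} (G : wgraph R V) (T : topologicalType).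
Variables (U : T -> V -> R).
Hypothesis U_cont : forall x, continuous (fun w => U w x).

Lemma continuous_sumr (I : Type) (s : seq I) (f : I -> T -> R) :
  (forall i, continuous (f i)) -> continuous (fun w => \sum_(i <- s) f i w).
Proof.
move=> fc; elim: s => [|i s IH] w.
  by under eq_fun do rewrite big_nil; exact: cvg_cst.
by under eq_fun do rewrite big_cons; apply: cvgD; [exact: fc|exact: IH].
Qed.

Lemma continuous_Gam z : continuous (fun w => Gam G (U w) (U w) z).
Proof.
move=> w; apply: cvgMl_tmp; under eq_fun do rewrite sum_adjE; rewrite sum_adjE.
move: w; apply: continuous_sumr => y w.
by apply: cvgM; [apply: cvgMl_tmp|]; apply: cvgB; exact: U_cont.
Qed.

Lemma continuous_grad_powR r z : 0 <= r -> continuous (fun w => grad G (U w) z `^ r).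
Proof.
move=> r0; under eq_fun do rewrite grad_powR.
apply: continuous_powR_ge0; last exact: continuous_Gam.
- by move=> w; exact: Gam_ge0.
- by rewrite divr_ge0.
Qed.

Lemma continuous_pLaplacian p z : 2 <= p ->
  continuous (fun w => pLaplacian G p (U w) z).
Proof.
move=> p2; have p20 : 0 <= p - 2 by rewrite subr_ge0.
move=> w; apply: cvgMl_tmp; under eq_fun do rewrite sum_adjE; rewrite sum_adjE.
move: w; apply: continuous_sumr => y w.
apply: cvgM; last by apply: cvgB; exact: U_cont.
apply: cvgMr_tmp; apply: cvgD; exact: continuous_grad_powR.
Qed.

Lemma continuous_norm_powR_comp p z : 0 <= p -> continuous (fun w => `|U w z| `^ p).
Proof.
move=> p0 w.
apply: (@continuous_comp _ _ _ (fun w => U w z) (fun r => `|r| `^ p)).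
  exact: U_cont.
exact: continuous_norm_powR.
Qed.

Lemma continuous_energy p h (S : {fset V}) : 2 <= p ->
  continuous (fun w => energy G p h S (U w)).
Proof.
move=> p2 w; have p0 : 0 <= p by rewrite (le_trans _ p2).
apply: cvgD.
  move: w; apply: continuous_sumr => z w; apply: cvgMl_tmp; apply: cvgMr_tmp.
  move: w; apply: continuous_powR_ge0; last exact: continuous_Gam.
  - by move=> w; exact: Gam_ge0.
  - by rewrite divr_ge0.
move: w; apply: continuous_sumr => z w; apply: cvgMl_tmp; apply: cvgMr_tmp.
by apply: cvgMl_tmp; exact: continuous_norm_powR_comp.
Qed.

End continuity.

(** * Minimizers on finite vertex sets and the passage to a solution *)

Section galerkin.
Context {R : realType} {V : choiceType} (G : wgraph R V).
Implicit Types (u v w : V -> R) (x y z : V) (S : {fset V}) (s t : R).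
Local Notation mu := (vmeas G).
Variables (mu0 p q h0 l1 l2 : R) (F : V -> R * R -> R) (h1 h2 e1 e2 : V -> R).
Hypotheses (mu0_gt0 : 0 < mu0) (mu0_le : forall x, mu0 <= mu x).
Hypotheses (p2 : 2 <= p) (q2 : 2 <= q) (h0_gt0 : 0 < h0).
Hypothesis h_ge : forall x, h0 <= h1 x /\ h0 <= h2 x.
Hypothesis F_C1 : C1 F.
Hypothesis F00 : forall x, F x (0, 0) = 0.
Variables (c C0 : R) (D : V -> R).
Hypotheses (c_gt0 : 0 < c).
Hypothesis D_sum : forall S, \sum_(x <- S) mu x * D x <= C0.
Hypothesis coercive : forall x s t,
  c * (h1 x * `|s| `^ p + h2 x * `|t| `^ q) <=
  potential p q F l1 l2 h1 h2 e1 e2 x s t + D x.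

(** For pairs supported in [S] this is the whole functional, because [F x (0, 0) = 0]. *)
Definition Phi S u v : R := energy G p h1 S u + energy G q h2 S v -
  \sum_(z <- S) mu z * (F z (u z, v z) + l1 * e1 z * u z + l2 * e2 z * v z).

(** The nonnegative quantity that coercivity places, up to the error [D], below the integrand of the
    functional. *)
Definition energy_density u v z : R := mu z *
  (Gam G u u z `^ (p / 2) / p + Gam G v v z `^ (q / 2) / q +
   c * (h1 z * `|u z| `^ p + h2 z * `|v z| `^ q)).

Definition EL1 u v x := - pLaplacian G p u x + h1 x * `|u x| `^ (p - 2) * u x
                = Fs F x (u x) (v x) + l1 * e1 x.
Definition EL2 u v x := - pLaplacian G q v x + h2 x * `|v x| `^ (q - 2) * v x
                = Ft F x (u x) (v x) + l2 * e2 x.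

Let p0 : 0 < p. Proof. by rewrite (lt_le_trans _ p2). Qed.
Let q0 : 0 < q. Proof. by rewrite (lt_le_trans _ q2). Qed.
Let C0_ge0 : 0 <= C0.
Proof. by have := D_sum fset0; rewrite big_nil. Qed.
Let mu_ge0 x : 0 <= mu x. Proof. by rewrite ltW// vmeas_gt0. Qed.
Let h1_ge0 x : 0 <= h1 x.
Proof. by have [h _] := h_ge x; rewrite (le_trans _ h)// ltW. Qed.
Let h2_ge0 x : 0 <= h2 x.
Proof. by have [_ h] := h_ge x; rewrite (le_trans _ h)// ltW. Qed.

Lemma energy_density_ge0 u v z : 0 <= energy_density u v z.
Proof.
rewrite mulr_ge0// addr_ge0//.
  by rewrite addr_ge0// divr_ge0// ?powR_ge0// ltW.
by rewrite mulr_ge0 ?(ltW c_gt0)// addr_ge0// mulr_ge0// powR_ge0.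
Qed.

(** Summing [coercive] over [S] bounds the total density by [Phi S u v] plus the sum of the errors,
    and the latter is at most [C0] for every [S]. *)
Lemma energy_density_sum S u v : (forall x, x \notin S -> u x = 0 /\ v x = 0) ->
  Phi S u v <= 0 -> \sum_(z <- closed_nbhd G S) energy_density u v z <= C0.
Proof.
move=> uvS Phi0.
have -> : \sum_(z <- closed_nbhd G S) energy_density u v z =
    \sum_(z <- closed_nbhd G S) mu z * (Gam G u u z `^ (p / 2) / p) +
    \sum_(z <- closed_nbhd G S) mu z * (Gam G v v z `^ (q / 2) / q) +
    \sum_(z <- S) mu z * (c * (h1 z * `|u z| `^ p + h2 z * `|v z| `^ q)).
  rewrite [X in _ = _ + X](@big_fset_incl _ _ _ _ _ (closed_nbhd G S)); first last.
  - move=> z _ /uvS[-> ->]; rewrite !normr0 !powR0 ?gt_eqF//.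
    by rewrite !mulr0 addr0 !mulr0.
  - exact/fsubsetP/closed_nbhd_sub.
  by rewrite -!big_split/=; apply: eq_bigr => z _; rewrite /energy_density; ring.
have PhiE : Phi S u v =
    \sum_(z <- closed_nbhd G S) mu z * (Gam G u u z `^ (p / 2) / p) +
    \sum_(z <- closed_nbhd G S) mu z * (Gam G v v z `^ (q / 2) / q) +
    \sum_(z <- S) mu z * potential p q F l1 l2 h1 h2 e1 e2 z (u z) (v z).
  have -> : \sum_(z <- S) mu z * potential p q F l1 l2 h1 h2 e1 e2 z (u z) (v z) =
      \sum_(z <- S) mu z * (h1 z * `|u z| `^ p / p) +
      \sum_(z <- S) mu z * (h2 z * `|v z| `^ q / q) -
      \sum_(z <- S) mu z * (F z (u z, v z) + l1 * e1 z * u z + l2 * e2 z * v z).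
    rewrite -big_split/= -sumrB; apply: eq_bigr => z _; rewrite /potential.
    by ring.
  by rewrite /Phi /energy; ring.
apply: le_trans (D_sum S); rewrite -[leRHS]add0r -lerBlDr.
apply: le_trans Phi0; rewrite PhiE -addrA lerD2l -sumrB.
by apply: ler_sum => z _; rewrite -mulrBr ler_wpM2l// lerBlDr.
Qed.

(** A density at most [C0] at a vertex gives [c * h0 * mu0 * |u|^p <= C0] and the same for [|v|^q];
    adding the two roots gives one radius for both components, independent of [S]. *)
Definition box_radius : R :=
  (C0 / (c * h0 * mu0)) `^ p^-1 + (C0 / (c * h0 * mu0)) `^ q^-1.

Lemma energy_density_bound u v z : energy_density u v z <= C0 ->
  `|u z| <= box_radius /\ `|v z| <= box_radius.
Proof.
move=> uv; have [hz1 hz2] := h_ge z.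
have k0 : 0 < c * h0 * mu0 by rewrite !mulr_gt0.
have Gu : 0 <= Gam G u u z `^ (p / 2) / p by rewrite divr_ge0 ?powR_ge0// ltW.
have Gv : 0 <= Gam G v v z `^ (q / 2) / q by rewrite divr_ge0 ?powR_ge0// ltW.
have Pu := powR_ge0 `|u z| p; have Pv := powR_ge0 `|v z| q.
have B : c * h0 * (`|u z| `^ p + `|v z| `^ q) * mu0 <= C0.
  apply: le_trans uv; rewrite /energy_density mulrC.
  apply: ler_pM => //; [exact: ltW|by rewrite mulr_ge0 ?addr_ge0// mulr_ge0// ltW|].
  apply: (@le_trans _ _ (c * (h1 z * `|u z| `^ p + h2 z * `|v z| `^ q))); last first.
    by rewrite lerDr addr_ge0.
  by rewrite -mulrA ler_pM2l// mulrDr lerD// ler_wpM2r.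
have root (r a : R) : 0 < r -> `|a| `^ r <= C0 / (c * h0 * mu0) ->
    `|a| <= (C0 / (c * h0 * mu0)) `^ r^-1.
  move=> r0 ar; rewrite -[leLHS]powRr1// -(divff (lt0r_neq0 r0)) powRrM.
  by rewrite ge0_ler_powR// ?nnegrE ?powR_ge0 ?invr_ge0 ?divr_ge0// ltW.
split.
  rewrite /box_radius ler_wpDr ?powR_ge0// root// ler_pdivlMr//.
  apply: le_trans B; rewrite [leRHS]mulrAC [leRHS]mulrC ler_wpM2r ?lerDl//.
  exact: ltW.
rewrite /box_radius ler_wpDl ?powR_ge0// root// ler_pdivlMr//.
apply: le_trans B; rewrite [leRHS]mulrAC [leRHS]mulrC ler_wpM2r ?lerDr//.
exact: ltW.
Qed.

Let F_diff x (z : R * R) : differentiable (F x) z. Proof. by have [] := F_C1 x. Qed.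

(** Testing with the indicator of [x] isolates the equation at [x], since [mu x] is positive. *)
Let EL_collapse (w : V -> R) S x (d : V -> R) : x \in S ->
  (w = fun y => (y == x)%:R) ->
  \sum_(z <- S) mu z * w z * d z = 0 -> d x = 0.
Proof.
move=> xS ->; rewrite (big_fsetD1 x)//= eqxx mulr1 big1_seq ?addr0; last first.
  move=> z /andP[_]; rewrite in_fsetD1 => /andP[/negbTE -> _].
  by rewrite mulr0 mul0r.
by move/eqP; rewrite mulf_eq0 gt_eqF ?vmeas_gt0// => /eqP.
Qed.

Let is_derive_line (a b t : R) : is_derive t (1 : R) (fun s : R => a + s * b) b.
Proof.
have := is_deriveD (is_derive_cst a t 1)
  (is_deriveZ b (is_derive_id t (1 : R))).
rewrite (_ : _ + _ = (fun s : R => a + s * b)).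
  by move/is_derive_eq; apply; rewrite add0r -[LHS]/(b * 1) mulr1.
by apply/funext => s; rewrite -[LHS]/(a + b * s) mulrC.
Qed.

Lemma is_derive_Phi1 S u v w t : (forall x, x \notin S -> w x = 0) ->
  is_derive t (1 : R) (fun s => Phi S (fun x => u x + s * w x) v)
  (\sum_(z <- S) mu z * w z *
     (- pLaplacian G p (fun x => u x + t * w x) z +
      h1 z * `|u z + t * w z| `^ (p - 2) * (u z + t * w z)
      - (Fs F z (u z + t * w z) (v z) + l1 * e1 z))).
Proof.
move=> wS.
have d1 := is_derive_energy G h1 u t p2 wS.
have d2 : is_derive t (1 : R)
    (fun s => \sum_(z <- S) mu z *
      (F z (u z + s * w z, v z) + l1 * e1 z * (u z + s * w z) + l2 * e2 z * v z))
    (\sum_(z <- S) mu z * w z * (Fs F z (u z + t * w z) (v z) + l1 * e1 z)).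
  apply: is_derive_sumr => z.
  have dF : is_derive (u z + t * w z) (1 : R) (fun r => F z (r, v z))
      (Fs F z (u z + t * w z) (v z)).
    by split; [exact: derivable_Fl|rewrite /Fs derive1E].
  have da := is_derive_line (u z) (w z) t.
  have dFa := @is_derive1_comp _ _ (fun s => u z + s * w z) t _ _ dF da.
  have := is_deriveZ (mu z) (is_deriveD (is_deriveD dFa
    (is_deriveZ (l1 * e1 z) da)) (is_derive_cst (l2 * e2 z * v z) t 1)).
  rewrite (_ : _ \*: _ = (fun s => mu z * (F z (u z + s * w z, v z) +
    l1 * e1 z * (u z + s * w z) + l2 * e2 z * v z))); last exact/funext.
  move/is_derive_eq; apply; rewrite -[LHS]/(mu z * (_ + l1 * e1 z * w z + 0)).
  by ring.
have := is_deriveB (is_deriveD d1 (is_derive_cst (energy G q h2 S v) t 1)) d2.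
rewrite -[X in is_derive _ _ X _]/(fun s => Phi S (fun x => u x + s * w x) v).
move/is_derive_eq; apply; rewrite addr0 -sumrB.
by apply: eq_bigr => z _; rewrite mulrBr.
Qed.

Lemma is_derive_Phi2 S u v w t : (forall x, x \notin S -> w x = 0) ->
  is_derive t (1 : R) (fun s => Phi S u (fun x => v x + s * w x))
  (\sum_(z <- S) mu z * w z *
     (- pLaplacian G q (fun x => v x + t * w x) z +
      h2 z * `|v z + t * w z| `^ (q - 2) * (v z + t * w z)
      - (Ft F z (u z) (v z + t * w z) + l2 * e2 z))).
Proof.
move=> wS.
have d1 := is_derive_energy G h2 v t q2 wS.
have d2 : is_derive t (1 : R)
    (fun s => \sum_(z <- S) mu z *
      (F z (u z, v z + s * w z) + l1 * e1 z * u z + l2 * e2 z * (v z + s * w z)))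
    (\sum_(z <- S) mu z * w z * (Ft F z (u z) (v z + t * w z) + l2 * e2 z)).
  apply: is_derive_sumr => z.
  have dF : is_derive (v z + t * w z) (1 : R) (fun r => F z (u z, r))
      (Ft F z (u z) (v z + t * w z)).
    by split; [exact: derivable_Fr|rewrite /Ft derive1E].
  have da := is_derive_line (v z) (w z) t.
  have dFa := @is_derive1_comp _ _ (fun s => v z + s * w z) t _ _ dF da.
  have := is_deriveZ (mu z) (is_deriveD (is_deriveD dFa
    (is_derive_cst (l1 * e1 z * u z) t 1)) (is_deriveZ (l2 * e2 z) da)).
  rewrite (_ : _ \*: _ = (fun s => mu z * (F z (u z, v z + s * w z) +
    l1 * e1 z * u z + l2 * e2 z * (v z + s * w z)))); last exact/funext.
  move/is_derive_eq; apply; rewrite -[LHS]/(mu z * (_ + 0 + l2 * e2 z * w z)).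
  by ring.
have := is_deriveB (is_deriveD (is_derive_cst (energy G p h1 S u) t 1) d1) d2.
rewrite -[X in is_derive _ _ X _]/(fun s => Phi S u (fun x => v x + s * w x)).
move/is_derive_eq; apply; rewrite add0r -sumrB.
by apply: eq_bigr => z _; rewrite mulrBr.
Qed.

Let derive_zero_at_min (f : R -> R) (d : R -> R) :
  (forall t, is_derive t (1 : R) f (d t)) ->
  (forall t, `|t| < 1 -> f 0 <= f t) -> d 0 = 0.
Proof.
move=> fd fmin.
have H : is_derive (0 : R) (1 : R) f 0.
  apply: (@derive1_at_min _ f (-1) 1) => //.
  - by rewrite in_itv/= ltr01 ltrN10.
  - by move=> t; rewrite in_itv/= -ltr_norml => /fmin.
have [_ <-] := fd 0; by have [_ ->] := H.
Qed.

Lemma continuous_Phi (T : topologicalType) (U W : T -> V -> R) S :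
  (forall x, continuous (fun a => U a x)) ->
  (forall x, continuous (fun a => W a x)) ->
  continuous (fun a => Phi S (U a) (W a)).
Proof.
move=> Uc Wc w; apply: cvgB.
  by apply: cvgD; [exact: (continuous_energy Uc)|exact: (continuous_energy Wc)].
move: w; apply: continuous_sumr => z w; apply: cvgMl_tmp.
apply: cvgD; last by apply: cvgMl_tmp; exact: Wc.
apply: cvgD; last by apply: cvgMl_tmp; exact: Uc.
apply: (@continuous_comp _ _ _ (fun a => (U a z, W a z)) (F z)).
  exact: cvg_pair (Uc z w) (Wc z w).
exact: differentiable_continuous.
Qed.

(* The box is one unit larger than the a priori bound, so the minimizer over it
   can be perturbed at any vertex of [S]. *)
Lemma galerkin S : exists u v,
  [/\ forall x, x \notin S -> u x = 0 /\ v x = 0,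
      forall x, `|u x| <= box_radius /\ `|v x| <= box_radius,
      \sum_(z <- closed_nbhd G S) energy_density u v z <= C0 &
      forall x, x \in S -> EL1 u v x /\ EL2 u v x].
Proof.
(* A pair of functions is one point of a product of lines: [true] marks the coordinates of [u],
   [false] those of [v]. *)
pose X := prod_topology (fun _ : V * bool => R).
pose M := box_radius + 1.
have rad0 : 0 <= box_radius by rewrite addr_ge0// powR_ge0.
(* Coordinates outside [S] are frozen at [0]. *)
pose A (i : V * bool) : set R := if i.1 \in S then `[- M, M]%classic else [set 0].
have A_compact : compact ([set f | forall i, A i (f i)] : set X).
  apply: (@tychonoff _ (fun _ => R) A) => i; rewrite /A.
  by case: ifP => _; [exact: segment_compact|exact: compact_set1].
pose uu (w : X) x : R := w (x, true); pose vv (w : X) x : R := w (x, false).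
have uu_cont x : continuous (fun w : X => uu w x).
  exact: (@proj_continuous _ (fun _ => R) (x, true)).
have vv_cont x : continuous (fun w : X => vv w x).
  exact: (@proj_continuous _ (fun _ => R) (x, false)).
have Phi_cont : continuous (fun w : X => Phi S (uu w) (vv w)).
  exact: (continuous_Phi uu_cont vv_cont).
have A0 : ([set f | forall i, A i (f i)] : set X) (fun=> 0).
  move=> i /=; rewrite /A; case: ifP => //= _.
  by rewrite in_itv/= oppr_le0 andbb addr_ge0.
have [w /set_mem/= wA wmin] := @compact_EVT_min X R (fun w : X => Phi S (uu w) (vv w))
  [set f | forall i, A i (f i)] (ex_intro _ _ A0) A_compact
  (continuous_subspaceT Phi_cont).
pose pr u v : X := fun i => if i.2 then u i.1 else v i.1.
have prA u v : (forall x, x \notin S -> u x = 0 /\ v x = 0) ->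
    (forall x, x \in S -> `|u x| <= M /\ `|v x| <= M) ->
    Phi S (uu w) (vv w) <= Phi S u v.
  move=> uvS uvM; apply: (wmin (pr u v)); apply/mem_set => -[x b].
  rewrite /A /pr/=; case: ifPn => [/uvM|/uvS] [xu xv]; last by case: b.
  by rewrite /= in_itv/= -ler_norml; case: b.
have wS x : x \notin S -> uu w x = 0 /\ vv w x = 0.
  move=> /negbTE xS; have := wA (x, true); have := wA (x, false).
  by rewrite /A/= xS.
(* The zero pair is a competitor, and [Phi] vanishes there. *)
have Phi0 : Phi S (uu w) (vv w) <= 0.
  have -> : 0 = Phi S (fun=> 0) (fun=> 0).
    have G0 z : Gam G (fun=> 0) (fun=> 0) z = 0.
      by rewrite /Gam sum_adjE big1 ?mulr0// => y _; rewrite subrr mulr0.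
    rewrite /Phi /energy !big1 ?addr0 ?subrr// => z _.
    - by rewrite F00 !mulr0 !addr0 mulr0.
    - by rewrite normr0 powR0 ?gt_eqF// mulr0 mul0r mulr0.
    - by rewrite G0 powR0 ?mul0r ?mulr0// gt_eqF// divr_gt0.
    - by rewrite normr0 powR0 ?gt_eqF// mulr0 mul0r mulr0.
    - by rewrite G0 powR0 ?mul0r ?mulr0// gt_eqF// divr_gt0.
  apply: prA => // x _; rewrite normr0.
  by split; rewrite addr_ge0.
have Ew := energy_density_sum wS Phi0.
(* The density at one vertex is at most the total density, so the minimizer stays at distance at
   least [1] from the faces of the box at the vertices of [S]. *)
have wB x : `|uu w x| <= box_radius /\ `|vv w x| <= box_radius.
  have [xS|/wS[-> ->]] := boolP (x \in S); last by rewrite normr0.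
  apply: energy_density_bound; apply: le_trans Ew.
  rewrite (big_fsetD1 x)/=; last exact: closed_nbhd_sub.
  by rewrite lerDl sumr_ge0// => z _; exact: energy_density_ge0.
exists (uu w), (vv w); split=> // x xS.
pose d : V -> R := fun y => (y == x)%:R.
have dS y : y \notin S -> d y = 0.
  by move=> yS; rewrite /d; case: eqP yS => // ->; rewrite xS.
have d1 y : `|d y| <= 1 by rewrite /d; case: eqP; rewrite ?normr1 ?normr0.
have small (a t : R) y : `|a| <= box_radius -> `|t| < 1 -> `|a + t * d y| <= M.
  move=> aM t1; apply: le_trans (ler_normD _ _) _; apply: lerD => //.
  by rewrite normrM mulr_ile1// ltW.
have line0 (f : V -> R) : (fun y => f y + 0 * d y) = f.
  by apply/funext => y; rewrite mul0r addr0.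
split.
  have := derive_zero_at_min (fun t => is_derive_Phi1 (uu w) (vv w) t dS).
  rewrite !line0 => H.
  have {}H := EL_collapse xS erefl (H _).
  rewrite mul0r addr0 in H; apply/eqP; rewrite -subr_eq0; apply/eqP; apply: H.
  move=> t t1; apply: prA => y yS.
    by have [-> ->] := wS y yS; rewrite dS// mulr0 addr0.
  have [uM vM] := wB y; split; first exact: small.
  by apply: le_trans vM _; rewrite lerDl.
have := derive_zero_at_min (fun t => is_derive_Phi2 (uu w) (vv w) t dS).
rewrite !line0 => H.
have {}H := EL_collapse xS erefl (H _).
rewrite mul0r addr0 in H; apply/eqP; rewrite -subr_eq0; apply/eqP; apply: H.
move=> t t1; apply: prA => y yS.
  by have [-> ->] := wS y yS; rewrite dS// mulr0 addr0.
have [uM vM] := wB y; split; last exact: small.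
by apply: le_trans uM _; rewrite lerDl.
Qed.

(** The equation at a vertex and a finite sum of densities depend continuously on finitely many
    coordinates. *)
Lemma closed_good (T : topologicalType) (U W : T -> V -> R) S :
  (forall x, continuous (fun a => U a x)) ->
  (forall x, continuous (fun a => W a x)) ->
  closed [set a | (forall x, x \in S -> EL1 (U a) (W a) x /\ EL2 (U a) (W a) x) /\
    \sum_(z <- S) energy_density (U a) (W a) z <= C0].
Proof.
move=> Uc Wc.
have closed_zero (f g : T -> R) : continuous f -> continuous g ->
    closed [set a | f a = g a].
  move=> fc gc; rewrite (_ : mkset _ = (fun a => f a - g a) @^-1` [set x | x = 0]).
    apply: preimage_closed; last exact: closed_eq.
    by move=> a _; apply: cvgB; [exact: fc|exact: gc].
  by apply/seteqP; split=> [a /= ->|a /= /subr0_eq]; first exact: subrr.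
have pair_cont x : continuous (fun a => (U a x, W a x)).
  by move=> a; exact: cvg_pair (Uc x a) (Wc x a).
have lhs_cont r h (Y : T -> V -> R) x : 2 <= r ->
    (forall x, continuous (fun a => Y a x)) ->
    continuous (fun a => - pLaplacian G r (Y a) x + h x * `|Y a x| `^ (r - 2) * Y a x).
  move=> r2 Yc a; apply: cvgD.
    by apply: cvgN; exact: (continuous_pLaplacian Yc).
  apply: cvgM; last exact: Yc.
  apply: cvgMl_tmp; apply: (continuous_norm_powR_comp Yc).
  by rewrite subr_ge0.
have rhs_cont (K : R * R -> R) (k : R) x : continuous K ->
    continuous (fun a => K (U a x, W a x) + k).
  move=> Kc a; apply: cvgD; last exact: cvg_cst.
  apply: (@continuous_comp _ _ _ (fun a => (U a x, W a x)) K); last exact: Kc.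
  exact: pair_cont.
have cl1 x : closed [set a | EL1 (U a) (W a) x].
  have [_ Fsc _] := F_C1 x.
  by apply: closed_zero; [exact: lhs_cont|exact: (rhs_cont _ _ x Fsc)].
have cl2 x : closed [set a | EL2 (U a) (W a) x].
  have [_ _ Ftc] := F_C1 x.
  by apply: closed_zero; [exact: lhs_cont|exact: (rhs_cont _ _ x Ftc)].
have clE : closed [set a | \sum_(z <- S) energy_density (U a) (W a) z <= C0].
  apply: (@preimage_closed _ _
    (fun a => \sum_(z <- S) energy_density (U a) (W a) z) [set x | x <= C0]);
    last exact: closed_le.
  move=> a _; move: a; apply: continuous_sumr => z a; apply: cvgMl_tmp.
  have q0' : 0 <= q by exact: ltW.
  have p0' : 0 <= p by exact: ltW.
  apply: cvgD.
    apply: cvgD; apply: cvgMr_tmp; move: a; apply: continuous_powR_ge0 => //.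
    - by move=> a; exact: Gam_ge0.
    - by rewrite divr_ge0.
    - exact: continuous_Gam.
    - by move=> a; exact: Gam_ge0.
    - by rewrite divr_ge0.
    - exact: continuous_Gam.
  apply: cvgMl_tmp; apply: cvgD; apply: cvgMl_tmp.
    exact: continuous_norm_powR_comp.
  exact: continuous_norm_powR_comp.
rewrite (_ : mkset _ = (\bigcap_(x in [set` S]) ([set a | EL1 (U a) (W a) x] `&`
    [set a | EL2 (U a) (W a) x])) `&`
    [set a | \sum_(z <- S) energy_density (U a) (W a) z <= C0]).
  by apply: closedI => //; apply: closed_bigI => x _; exact: closedI.
by apply/seteqP; split=> a [EL E]; split.
Qed.

(** The sets [A] intersected with [good S] are nonempty by [galerkin] and shrink as [S] grows. A
    cluster point of the filter they generate in the compact box lies in each closed set [good S],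
    hence solves the equation at every vertex. *)
Lemma exists_solution : exists u v,
  (forall x, EL1 u v x /\ EL2 u v x) /\
  (forall S, \sum_(z <- S) energy_density u v z <= C0).
Proof.
pose X := prod_topology (fun _ : V * bool => R).
pose uu (w : X) x : R := w (x, true); pose vv (w : X) x : R := w (x, false).
have uu_cont x : continuous (fun w : X => uu w x).
  exact: (@proj_continuous _ (fun _ => R) (x, true)).
have vv_cont x : continuous (fun w : X => vv w x).
  exact: (@proj_continuous _ (fun _ => R) (x, false)).
pose A : set X := [set f | forall i, `[- box_radius, box_radius]%classic (f i)].
have A_compact : compact A.
  apply: (@tychonoff _ (fun _ => R) (fun _ => `[- box_radius, box_radius]%classic)).
  by move=> i; exact: segment_compact.
pose good S : set X := [set w | (forall x, x \in S -> EL1 (uu w) (vv w) x /\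
  EL2 (uu w) (vv w) x) /\ \sum_(z <- S) energy_density (uu w) (vv w) z <= C0].
have goodS S S' : (S `<=` S')%fset -> good S' `<=` good S.
  move=> SS' w [EL E]; split; first by move=> x /(fsubsetP SS') /EL.
  by apply: le_trans E; apply: ler_sum_fset => // z; exact: energy_density_ge0.
have good0 S : A `&` good S !=set0.
  have [u [v [uvS uvM E EL]]] := galerkin S.
  pose w : X := fun i => if i.2 then u i.1 else v i.1.
  exists w; split.
    move=> [x b]; rewrite /= in_itv/= -ler_norml /w/=; have [uM vM] := uvM x.
    by case: b.
  (* The bound from [galerkin] is over [closed_nbhd G S]; nonnegativity of the density restricts it
     to [S]. *)
  apply: (goodS S S) => //; split=> //.
  apply: le_trans E; apply: ler_sum_fset; last by move=> z; exact: energy_density_ge0.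
  exact/fsubsetP/closed_nbhd_sub.
have good_closed S : closed (good S).
  apply: closed_good => //.
(* Finite sets directed by inclusion play the role of an exhaustion of [V]. *)
pose FF := filter_from [set: {fset V}] (fun S => A `&` good S).
have FFP : ProperFilter FF.
  apply: filter_from_proper; last by move=> S _; exact: good0.
  apply: filter_fromT_filter; first by exists fset0.
  move=> S S'; exists (S `|` S')%fset => w [Aw gw]; split; split=> //.
  - by apply: goodS gw; exact: fsubsetUl.
  - by apply: goodS gw; exact: fsubsetUr.
have [|w [_ clw]] := A_compact FF FFP.
  by exists fset0 => //; exact: subIsetl.
have gw S : good S w.
  apply: good_closed => B /clw; apply.
  by exists S => //; exact: subIsetr.
exists (uu w), (vv w); split=> [x|S].
  by have [EL _] := gw [fset x]%fset; apply: EL; rewrite inE.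
by have [] := gw S.
Qed.

End galerkin.

(** * Truncation of real numbers at a level *)

Section truncation.
Context {R : realType}.
Implicit Types (a b e : R).

(* For [0 <= e] this is [max (- e) (min a e)]. *)
Definition clip e a : R := (`|a + e| - `|a - e|) / 2.

(** For [0 <= e] this is soft thresholding: [a] is moved towards [0] by [e] and stops at [0]. *)
Definition trunc e a : R := a - clip e a.

Lemma clip_lipschitz e a b : `|clip e a - clip e b| <= `|a - b|.
Proof.
have H1 := ler_dist_dist (a + e) (b + e).
have H2 := ler_dist_dist (a - e) (b - e).
rewrite (_ : a + e - (b + e) = a - b) in H1; last by ring.
rewrite (_ : a - e - (b - e) = a - b) in H2; last by ring.
move: H1 H2; rewrite /clip !ler_norml => /andP[H1 H2] /andP[H3 H4].
by apply/andP; split; lra.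
Qed.

Lemma clip0 e : clip e 0 = 0.
Proof. by rewrite /clip add0r sub0r normrN subrr mul0r. Qed.

Lemma clip0l a : clip 0 a = 0.
Proof. by rewrite /clip addr0 subr0 subrr mul0r. Qed.

Lemma clip_bound e a : 0 <= e -> `|clip e a| <= e.
Proof.
move=> e0; have H := ler_dist_dist (a + e) (a - e).
rewrite (_ : a + e - (a - e) = 2 * e) in H; last by ring.
rewrite (ger0_norm (_ : 0 <= 2 * e)) in H; last by rewrite mulr_ge0.
move: H; rewrite /clip !ler_norml => /andP[H1 H2].
by apply/andP; split; lra.
Qed.

Lemma clip_id e a : `|a| <= e -> clip e a = a.
Proof.
rewrite ler_norml => /andP[H1 H2]; rewrite /clip ger0_norm; last by lra.
by rewrite ler0_norm; last (by lra); field.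
Qed.

(** Since [clip] is 1-Lipschitz, the increment of [clip] cannot outweigh [a - b]. This makes the
    gradient term nonnegative when an equation for [u] is tested with a truncation of [u]. *)
Lemma trunc_mono e a b : 0 <= (a - b) * (trunc e a - trunc e b).
Proof.
have := clip_lipschitz e a b.
rewrite (_ : trunc e a - trunc e b = (a - b) - (clip e a - clip e b)); last first.
  by rewrite /trunc; ring.
move: (a - b) (clip e a - clip e b) => x y.
rewrite mulrBr subr_ge0 => yx.
apply: le_trans (ler_norm _) _; rewrite normrM -expr2 -real_normK ?num_real//.
by rewrite expr2 ler_wpM2l.
Qed.

Lemma trunc_sign e a : a * trunc e a = `|a| * `|trunc e a|.
Proof.
have := trunc_mono e a 0; rewrite /trunc clip0 !subr0 => /ger0_norm <-.
by rewrite normrM.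
Qed.

Lemma trunc_le e a : 0 <= e -> `|trunc e a| <= `|a|.
Proof.
move=> e0; have [a0|a0] := leP 0 a.
  have -> : `|trunc e a| = trunc e a.
    apply: ger0_norm; rewrite subr_ge0; apply: le_trans (ler_norm _) _.
    by have := clip_lipschitz e a 0; rewrite clip0 !subr0 (ger0_norm a0).
  rewrite (ger0_norm a0) gerBl divr_ge0// subr_ge0.
  by rewrite ler_norml (@ger0_norm _ (a + e)) ?addr_ge0//; apply/andP; split; lra.
have -> : `|trunc e a| = - trunc e a.
  apply: ler0_norm; rewrite subr_le0.
  have := clip_lipschitz e a 0; rewrite clip0 !subr0 (ltr0_norm a0) ler_norml.
  by rewrite opprK => /andP[].
rewrite (ltr0_norm a0) lerN2 lerBrDr gerDl.
rewrite -oppr_ge0 -mulNr opprB divr_ge0// subr_ge0.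
by rewrite ler_norml (@ler0_norm _ (a - e)); last (by lra); apply/andP; split; lra.
Qed.

Lemma trunc_eq0 e a : trunc e a != 0 -> e < `|a|.
Proof.
by apply: contraR; rewrite -leNgt => /clip_id; rewrite /trunc => ->; rewrite subrr.
Qed.

Lemma trunc_dist e a : 0 <= e -> `|a| <= `|trunc e a| + e.
Proof.
move=> e0; rewrite -[X in `|X| <= _](subrK (clip e a)).
by apply: le_trans (ler_normD _ _) _; rewrite lerD2l clip_bound.
Qed.

End truncation.

(** * Integrals over [V], and finite energy implies membership in the Sobolev space *)

Section integrals.
Context {R : realType} {V : choiceType} (G : wgraph R V).
Implicit Types (f u : V -> R) (S : {fset V}).
Local Notation mu := (vmeas G).

Lemma integralV_le f (C : R) : (forall x, 0 <= f x) ->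
  (forall S, \sum_(x <- S) f x * mu x <= C) -> (integralV G f <= C%:E)%E.
Proof.
move=> f0 fC; apply: ge_ereal_sup => _ [A [fA _] <-].
rewrite fsbig_finite//= sumEFin lee_fin; exact: fC.
Qed.

Lemma integralV_ge0 f : (forall x, 0 <= f x) -> (0 <= integralV G f)%E.
Proof.
move=> f0; apply: esum_ge0 => x _.
by rewrite lee_fin mulr_ge0// ltW// vmeas_gt0.
Qed.

Lemma sum_le_integralV f S : (forall x, 0 <= f x) -> (integralV G f < +oo)%E ->
  \sum_(x <- S) f x * mu x <= fine (integralV G f).
Proof.
move=> f0 foo; rewrite -lee_fin fineK; last first.
  by rewrite ge0_fin_numE// integralV_ge0.
apply: esum_ge; exists [set` S]; first by split=> //; exact: finite_fset.
by rewrite fsbig_finite//= set_fsetK sumEFin.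
Qed.

(** Chebyshev's argument: each vertex of the set contributes at least [e^p * mu0], so a large enough
    finite subset would exceed [C]. *)
Lemma finite_superlevel u (p mu0 C e : R) : 0 < mu0 -> (forall x, mu0 <= mu x) ->
  0 <= p -> 0 < e -> (forall S, \sum_(x <- S) `|u x| `^ p * mu x <= C) ->
  finite_set [set x | e < `|u x|].
Proof.
move=> mu00 mu0le p0 e0 uC; apply: contrapT => inf.
have k0 : 0 < e `^ p * mu0 by rewrite mulr_gt0// powR_gt0.
have [B BA nB] := infinite_set_fset (Num.bound (C / (e `^ p * mu0))) inf.
have : C < \sum_(x <- B) `|u x| `^ p * mu x.
  apply: (@lt_le_trans _ _ (\sum_(x <- B) e `^ p * mu0)).
    rewrite big_const_seq count_predT iter_addr_0 -mulr_natl -ltr_pdivrMr//.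
    apply: (@lt_le_trans _ _ (Num.bound (C / (e `^ p * mu0)))%:R).
      apply: archi_boundP; rewrite divr_ge0 ?(ltW k0)//.
      by have := uC fset0; rewrite big_nil.
    by rewrite ler_nat.
  rewrite !big_seq; apply: ler_sum => x xB.
  apply: ler_pM => //; [exact: powR_ge0|exact: ltW|].
  by rewrite ge0_ler_powR// ?nnegrE ?(ltW e0)// ltW//; exact: BA.
by rewrite ltNge uC.
Qed.

(** The approximants are the truncations of [u] at level [1 / (n + 1)]. The error is minus the
    clipped function, whose density [d] is dominated by the density [f] of [u] and vanishes at level
    [0]. *)
Lemma inW_of_bounded u (p mu0 C : R) : 0 < mu0 -> (forall x, mu0 <= mu x) ->
  2 <= p ->
  (forall S, \sum_(x <- S) (grad G u x `^ p + `|u x| `^ p) * mu x <= C) ->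
  inW G p u.
Proof.
move=> mu00 mu0le p2 uC.
have p0 : 0 < p by rewrite (lt_le_trans _ p2).
have mu_ge0 x : 0 <= mu x by rewrite ltW// vmeas_gt0.
pose U (e : R) : V -> R := fun x => clip e (u x).
pose f x := grad G u x `^ p + `|u x| `^ p.
pose d (e : R) x := grad G (U e) x `^ p + `|U e x| `^ p.
have f0 x : 0 <= f x by rewrite addr_ge0// powR_ge0.
have d0 e x : 0 <= d e x by rewrite addr_ge0// powR_ge0.
have df e x : d e x <= f x.
  rewrite lerD//.
    rewrite !grad_powR ge0_ler_powR// ?nnegrE ?Gam_ge0//.
      by rewrite divr_ge0// ltW.
    by apply: Gam_mono => y; exact: clip_lipschitz.
  rewrite ge0_ler_powR// ?nnegrE//; first exact: ltW.
  by have := clip_lipschitz e (u x) 0; rewrite clip0 !subr0.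
have Uc x : continuous (fun e => U e x).
  move=> e; apply: cvgMr_tmp; apply: cvgB; apply: cvg_norm.
    by apply: cvgD; [exact: cvg_cst|exact: cvg_id].
  by apply: cvgB; [exact: cvg_cst|exact: cvg_id].
have dc x : continuous (fun e => d e x).
  move=> e; apply: cvgD.
    by apply: (continuous_grad_powR Uc); exact: ltW.
  by apply: (continuous_norm_powR_comp Uc); exact: ltW.
have d00 x : d 0 x = 0.
  rewrite /d grad_powR (_ : Gam _ _ _ _ = 0); last first.
    rewrite /Gam sum_adjE big1 ?mulr0// => y _.
    by rewrite /U !clip0l subrr mulr0.
  by rewrite /U clip0l normr0 !powR0 ?addr0// gt_eqF// divr_gt0.
(* Dominated convergence by hand: a finite [S0] carries the supremum [sup E] of the sums of [f] up
   to [eta / 2]. On [S0] the sum of [d] is continuous in the level and tends to [0]; off [S0] it is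
   bounded by the tail of [f]. *)
have small (eta : R) : 0 < eta -> \forall n \near \oo,
    forall S, \sum_(x <- S) d (n.+1%:R^-1) x * mu x <= eta.
  move=> eta0.
  pose E := [set y | exists S, y = \sum_(x <- S) f x * mu x].
  have supE : has_sup E.
    split; first by exists (\sum_(x <- fset0) f x * mu x); exists fset0.
    by exists C => _ [S ->]; exact: uC.
  have [_ [S0 ->] S0E] := sup_adherent (divr_gt0 eta0 (ltr0Sn _ 1)) supE.
  have c0 : continuous (fun e : R => \sum_(x <- S0) d e x * mu x).
    by apply: continuous_sumr => x e; apply: cvgMr_tmp; exact: dc.
  have := cvg_comp _ _ (@cvg_harmonic R) (c0 0).
  rewrite big1 => [|x _]; last by rewrite d00 mul0r.
  move/cvgrPdist_le => /(_ _ (divr_gt0 eta0 (ltr0Sn _ 1))).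
  apply: filterS => n /=; rewrite sub0r normrN => dn S.
  apply: (@le_trans _ _ (\sum_(x <- (S `|` S0)%fset) d (n.+1%:R^-1) x * mu x)).
    by apply: ler_sum_fset; [exact: fsubsetUl|move=> x; rewrite mulr_ge0].
  have splitS (g : V -> R) : \sum_(x <- (S `|` S0)%fset) g x =
      \sum_(x <- S0) g x + \sum_(x <- (S `\` S0)%fset) g x.
    rewrite (big_fsetID _ (mem S0)); congr (_ + _).
      by apply: eq_fbigl => x; rewrite !inE/=; case: (x \in S0); rewrite ?andbF ?orbT.
    by apply: eq_fbigl => x; rewrite !inE/=; case: (x \in S0); rewrite ?andbF ?orbF ?andbT.
  have fS : \sum_(x <- (S `|` S0)%fset) f x * mu x <= sup E.
    by apply: (sup_upper_bound supE); exists (S `|` S0)%fset.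
  rewrite splitS in fS; rewrite splitS.
  have : \sum_(x <- (S `\` S0)%fset) d (n.+1%:R^-1) x * mu x <=
      \sum_(x <- (S `\` S0)%fset) f x * mu x.
    by apply: ler_sum => x _; rewrite ler_wpM2r.
  have := le_trans (ler_norm _) dn.
  move: S0E fS; move: (\sum_(x <- S0) _) (\sum_(x <- S0) _) => a b.
  move: (\sum_(x <- _) _) (\sum_(x <- _) _) (sup E) => a' b' s *; lra.
exists (fun n x => trunc n.+1%:R^-1 (u x)).
  move=> n; rewrite /Cc.
  apply: (@sub_finite_set _ _ [set x | n.+1%:R^-1 < `|u x|]).
    by move=> x /=; exact: trunc_eq0.
  apply: (@finite_superlevel u p mu0 C) => //; first exact: ltW.
  move=> S; apply: le_trans (uC S); apply: ler_sum => x _.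
  by rewrite ler_wpM2r// lerDr powR_ge0.
have gradN (w : V -> R) x : grad G (fun y => - w y) x = grad G w x.
  rewrite /grad /Gam; congr (Num.sqrt (_ * _)); apply: eq_sum_adj => y _; ring.
have dE n : (fun x => grad G (fun x => trunc n.+1%:R^-1 (u x) - u x) x `^ p +
      `|trunc n.+1%:R^-1 (u x) - u x| `^ p) = d n.+1%:R^-1.
  apply/funext => x; rewrite /d.
  have -> : (fun x => trunc n.+1%:R^-1 (u x) - u x) = (fun x => - U n.+1%:R^-1 x).
    by apply/funext => y; rewrite /trunc /U; ring.
  rewrite gradN -(normrN (U _ x)) (_ : - U _ x = trunc n.+1%:R^-1 (u x) - u x)//.
  by rewrite /trunc /U; ring.
(* Finiteness is recorded together with the bound because convergence in the extended reals is
   deduced from that of the real parts. *)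
have normWn (eta : R) : 0 < eta -> \forall n \near \oo,
    [/\ normW G p (fun x => trunc n.+1%:R^-1 (u x) - u x) \is a fin_num,
        0 <= fine (normW G p (fun x => trunc n.+1%:R^-1 (u x) - u x)) &
        fine (normW G p (fun x => trunc n.+1%:R^-1 (u x) - u x)) <= eta].
  move=> eta0; have := small _ (powR_gt0 p eta0).
  apply: filterS => n dn; rewrite /normW dE.
  have := integralV_le (d0 _) dn; have := integralV_ge0 (d0 n.+1%:R^-1).
  case: (integralV _ _) => [r| |]//; rewrite !lee_fin => r0 r1.
  rewrite poweR_EFin; split=> //=; first exact: powR_ge0.
  rewrite -[leRHS](powRr1 (ltW eta0)) -(divff (lt0r_neq0 p0)) powRrM.
  by rewrite ge0_ler_powR// ?nnegrE ?powR_ge0// invr_ge0 ltW.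
apply: cvg_EFin.
  by have := normWn _ ltr01; apply: filterS => n [].
apply/cvgrPdist_le => eta eta0; have := normWn _ eta0.
by apply: filterS => n [_ n0 n1]; rewrite sub0r normrN ger0_norm.
Qed.

End integrals.

(** * Sup-norm bounds by testing with truncations, and the weighted space *)

Section a_priori_bound.
Context {R : realType} {V : choiceType} (G : wgraph R V).
Implicit Types (f u e : V -> R) (S : {fset V}).
Local Notation mu := (vmeas G).
Variables (mu0 p : R).
Hypotheses (mu0_gt0 : 0 < mu0) (mu0_le : forall x, mu0 <= mu x) (p2 : 2 <= p).

Let p0 : 0 < p. Proof. by rewrite (lt_le_trans _ p2). Qed.
Let p1 : 1 < p. Proof. by rewrite (lt_le_trans _ p2)// ltr1n. Qed.
Let mu_ge0 x : 0 <= mu x. Proof. by rewrite ltW// vmeas_gt0. Qed.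

Lemma hoelder_normL e (w : V -> R) S : inL G (p / (p - 1)) e ->
  \sum_(x <- S) `|e x| * `|w x| * mu x <=
  fine (normL G (p / (p - 1)) e) * (\sum_(x <- S) `|w x| `^ p * mu x) `^ p^-1.
Proof.
move=> eL.
have := weighted_hoelder S p1 mu_ge0 (fun x => normr_ge0 (e x)) (fun x => normr_ge0 (w x)).
move=> /le_trans; apply; rewrite ler_wpM2r ?powR_ge0//.
have e0 x : 0 <= `|e x| `^ (p / (p - 1)) by exact: powR_ge0.
have := sum_le_integralV S e0 eL; have := integralV_ge0 G e0; move: eL.
rewrite /inL /normL; case: (integralV _ _) => [r| |]//= _; rewrite lee_fin => r0 Sr.
rewrite ge0_ler_powR// ?nnegrE//.
  by rewrite invr_ge0 divr_ge0 ?(ltW p0)// subr_ge0 ltW.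
by apply: sumr_ge0 => x _; rewrite mulr_ge0// powR_ge0.
Qed.

(** Testing the equation with [w], the truncation of [u] at [e], and dropping the nonnegative
    gradient term gives [(h0 - m) * Y <= N * Y^(1/p)] for [Y] the sum of [|w|^p * mu]. Hence
    [Y^(1/p)] is at most the power [1 / (p - 1)] of [N / (h0 - m)], while [mu0 * |w x|^p <= Y] at
    each vertex. The last hypothesis is Hoelder's inequality for [g] with norm bound [N]. *)
Lemma sup_bound u h (k g : V -> R) (h0 m N C : R) :
  (forall S, \sum_(x <- S) `|u x| `^ p * mu x <= C) ->
  (forall x, h0 <= h x) -> m < h0 -> (forall x, 0 <= g x) -> 0 <= N ->
  (forall x, - pLaplacian G p u x + h x * `|u x| `^ (p - 2) * u x = k x) ->
  (forall x, `|k x| <= m * `|u x| `^ (p - 1) + g x) ->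
  (forall (w : V -> R) S, \sum_(x <- S) g x * `|w x| * mu x <=
     N * (\sum_(x <- S) `|w x| `^ p * mu x) `^ p^-1) ->
  forall x, `|u x| <= mu0 `^ (- p^-1) * (N / (h0 - m)) `^ (p - 1)^-1.
Proof.
move=> uC hh mh g0 N0 EL kb gN x.
have hm0 : 0 < h0 - m by rewrite subr_gt0.
(* Truncating costs at most [e], and the bound obtained for [w] does not depend on [e]. *)
apply/ler_addgt0Pr => e e0.
apply: le_trans (trunc_dist (u x) (ltW e0)) _; rewrite lerD2r.
pose w y := trunc e (u y).
have fS : finite_set [set y | e < `|u y|].
  exact: (finite_superlevel mu0_gt0 mu0_le (ltW p0) e0 uC).
pose S := fset_set [set y | e < `|u y|].
have wS y : y \notin S -> w y = 0.
  move=> yS; apply: contraNeq yS => /trunc_eq0 eu.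
  by rewrite in_fset_set//; apply: mem_set.
have parts := sum_by_parts G (fun y => grad G u y `^ (p - 2)) u wS.
have lap_ge0 : 0 <= \sum_(y <- S) mu y * w y * (- pLaplacian G p u y).
  under eq_bigr do rewrite mulrN.
  rewrite sumrN /pLaplacian -parts sumr_ge0// => y _.
  rewrite mulr_ge0// mulr_ge0 ?powR_ge0// /Gam mulr_ge0 ?invr_ge0 ?mulr_ge0//.
  rewrite sum_adjE big_seq sumr_ge0// => z; rewrite in_nbrs => yz.
  by rewrite -mulrA mulr_ge0 ?trunc_mono// ltW// weight_gt0.
have up1 y : `|u y| `^ (p - 2) * `|u y| = `|u y| `^ (p - 1).
  rewrite mulrC (_ : p - 2 = (p - 1) - 1); last by ring.
  by rewrite mulr_powRB1// subr_gt0.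
(* The equation replaces the Laplacian in [lap_ge0]; [u] and [w] have the same sign, so the
   potential term becomes a product of absolute values. *)
have main : (h0 - m) * \sum_(y <- S) mu y * (`|w y| * `|u y| `^ (p - 1)) <=
    \sum_(y <- S) g y * `|w y| * mu y.
  rewrite big_distrr/= -subr_ge0 -sumrB.
  apply: le_trans lap_ge0 _; apply: ler_sum => y _.
  have -> : - pLaplacian G p u y = k y - h y * `|u y| `^ (p - 2) * u y.
    by rewrite -EL addrK.
  have -> : mu y * w y * (k y - h y * `|u y| `^ (p - 2) * u y) =
      mu y * (w y * k y - h y * `|u y| `^ (p - 2) * (u y * w y)) by ring.
  rewrite trunc_sign -/(w y).
  have -> : h y * `|u y| `^ (p - 2) * (`|u y| * `|w y|) =
      h y * (`|w y| * `|u y| `^ (p - 1)) by rewrite -up1; ring.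
  rewrite [leRHS](_ : _ = mu y * (`|w y| * (m * `|u y| `^ (p - 1) + g y) -
      h0 * (`|w y| * `|u y| `^ (p - 1)))); last by ring.
  rewrite ler_wpM2l// lerB//.
    apply: le_trans (ler_norm _) _; rewrite normrM ler_wpM2l//.
  by rewrite ler_wpM2r// mulr_ge0// powR_ge0.
pose Y := \sum_(y <- S) `|w y| `^ p * mu y.
have Y0 : 0 <= Y by apply: sumr_ge0 => y _; rewrite mulr_ge0// powR_ge0.
have YX : (h0 - m) * Y <= N * Y `^ p^-1.
  apply: le_trans (gN w S); apply: le_trans main.
  rewrite ler_pM2l//; apply: ler_sum => y _; rewrite mulrC ler_wpM2l//.
  rewrite -(mulr_powRB1 (normr_ge0 (w y)) p0) ler_wpM2l//.
  rewrite ge0_ler_powR// ?nnegrE//; first by rewrite subr_ge0 ltW.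
  exact: trunc_le (ltW e0).
pose X := Y `^ p^-1.
have X0 : 0 <= X by exact: powR_ge0.
have XY : X `^ p = Y by rewrite -powRrM mulVf ?gt_eqF// powRr1.
(* For [X] nonzero, [YX] reads [(h0 - m) * X^p <= N * X], and one factor [X] cancels. *)
have XB : X <= (N / (h0 - m)) `^ (p - 1)^-1.
  have [->|Xn] := eqVneq X 0; first exact: powR_ge0.
  have Xgt0 : 0 < X by rewrite lt_neqAle eq_sym Xn.
  have : X `^ (p - 1) <= N / (h0 - m).
    rewrite ler_pdivlMr// -(ler_pM2l Xgt0) mulrA mulr_powRB1// XY.
    by rewrite mulrC (mulrC X).
  have p10 : 0 < p - 1 by rewrite subr_gt0.
  move=> XN; rewrite (_ : X = (X `^ (p - 1)) `^ (p - 1)^-1); last first.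
    by rewrite -powRrM divff ?gt_eqF// powRr1.
  rewrite ge0_ler_powR// ?nnegrE ?powR_ge0//.
    by rewrite invr_ge0 ltW.
  by rewrite divr_ge0// ltW.
have xY : `|w x| `^ p * mu0 <= Y.
  have [xS|/wS ->] := boolP (x \in S); last by rewrite normr0 powR0 ?gt_eqF// mul0r.
  rewrite /Y (big_fsetD1 x)//= ler_wpDr//.
    by apply: sumr_ge0 => y _; rewrite mulr_ge0// powR_ge0.
  by rewrite ler_wpM2l// powR_ge0.
have mu0p : 0 < mu0 `^ p^-1 by exact: powR_gt0.
rewrite powRN mulrC ler_pdivlMr//; apply: le_trans XB.
rewrite -[X in X * _](powRr1 (normr_ge0 (w x))) -(divff (lt0r_neq0 p0)) powRrM.
rewrite -powRM ?powR_ge0 ?(ltW mu0_gt0)//.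
rewrite /X ge0_ler_powR// ?nnegrE ?invr_ge0 ?(ltW p0)//.
by rewrite mulr_ge0 ?powR_ge0// ltW.
Qed.

(** The density [ed] controls the gradient power up to the factor [p], the weighted power of [u] up
    to [1 / c], and the unweighted one up to [1 / (c * h0)]. *)
Lemma inWh_of_bounded u h (ed : V -> R) (h0 c C : R) : 0 < h0 -> 0 < c ->
  (forall x, h0 <= h x) -> (forall S, \sum_(x <- S) ed x <= C) ->
  (forall x, mu x * (Gam G u u x `^ (p / 2) / p + c * (h x * `|u x| `^ p)) <= ed x) ->
  inWh G p h u /\ forall S, \sum_(x <- S) `|u x| `^ p * mu x <= C / (c * h0).
Proof.
move=> h00 c0 hh edC ued.
have Gm x : 0 <= Gam G u u x `^ (p / 2) / p by rewrite divr_ge0 ?powR_ge0// ltW.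
have hx x : 0 <= h x by rewrite (le_trans _ (hh x))// ltW.
have hu x : 0 <= h x * `|u x| `^ p by rewrite mulr_ge0// powR_ge0.
have edG x : Gam G u u x `^ (p / 2) * mu x <= p * ed x.
  apply: (@le_trans _ _ (p * (mu x * (Gam G u u x `^ (p / 2) / p)))).
    by rewrite le_eqVlt; apply/orP; left; apply/eqP; field; rewrite gt_eqF.
  rewrite ler_pM2l//; apply: le_trans (ued x); rewrite ler_wpM2l// lerDl.
  by rewrite mulr_ge0// ltW.
have edh x : h x * `|u x| `^ p * mu x <= c^-1 * ed x.
  rewrite ler_pdivlMl//; apply: le_trans (ued x).
  by rewrite mulrA mulrC ler_wpM2l// lerDr.
have edu x : `|u x| `^ p * mu x <= (c * h0)^-1 * ed x.
  rewrite invfM mulrAC ler_pdivlMr// mulrC; apply: le_trans (edh x).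
  by rewrite mulrA ler_wpM2r// ler_wpM2r// powR_ge0.
split; last first.
  move=> S; rewrite [leRHS]mulrC -ler_pdivrMl ?invr_gt0 ?mulr_gt0// invrK.
  apply: le_trans (edC S); rewrite big_distrr/=; apply: ler_sum => x _.
  by rewrite -ler_pdivlMl ?mulr_gt0.
split.
  apply: (@inW_of_bounded _ _ G u p mu0 (p * C + (c * h0)^-1 * C)) => // S.
  apply: (@le_trans _ _ ((p + (c * h0)^-1) * \sum_(x <- S) ed x)).
    rewrite big_distrr/=; apply: ler_sum => x _.
    by rewrite !mulrDl grad_powR lerD.
  by rewrite -mulrDl ler_wpM2l// addr_ge0 ?invr_ge0 ?mulr_ge0// ltW.
apply: (@le_lt_trans _ _ (c^-1 * C)%:E); last exact: ltry.
apply: integralV_le => // S.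
apply: (@le_trans _ _ (c^-1 * \sum_(x <- S) ed x)).
  by rewrite big_distrr/=; apply: ler_sum => x _.
by rewrite ler_wpM2l// invr_ge0 ltW.
Qed.

End a_priori_bound.

(** * Nontriviality, and assembly of the theorem *)

Lemma derive1_ge0_at_zero (R : realType) (psi : R -> R) (K beta : R) :
  1 < beta -> 0 < K -> psi 0 = 0 -> derivable psi 0 1 ->
  (forall s, - K * `|s| `^ beta <= psi s) -> 0 <= derive1 psi 0.
Proof.
move=> b1 K0 psi0 dpsi psiK; rewrite derive1E ['D_1 psi 0]cvg_at_rightE//.
apply/ler_addgt0Pr => e e0; rewrite -lerBlDr sub0r.
have b0 : 0 < beta - 1 by rewrite subr_gt0.
apply: limr_ge.
  rewrite -(cvg_at_rightE (fun h : R => h^-1 *: ((psi \o shift 0) _ - psi 0)))//.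
  apply: cvg_trans dpsi; apply: cvg_app.
  by move=> A [d d0 Ad]; exists d => // x xd /gt_eqF/negbT; exact: Ad.
(* For [h > 0] the difference quotient is at least [- K * h^(beta - 1)], which tends to [0] because
   [1 < beta]. *)
have c : (fun r : R => `|r| `^ (beta - 1)) @ (0 : R)^'+ --> (0 : R).
  apply: cvg_within_filter.
  have := @continuous_norm_powR R (beta - 1) (ltW b0) 0.
  by rewrite /continuous_at normr0 powR0// gt_eqF.
near=> h.
have h0 : 0 < h by near: h; exact: nbhs_right_gt.
have small : K * `|h| `^ (beta - 1) <= e.
  rewrite mulrC -ler_pdivlMr//; near: h.
  move/cvgrPdist_le : c => /(_ _ (divr_gt0 e0 K0)); apply: filterS => h.
  by rewrite sub0r normrN ger0_norm// powR_ge0.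
rewrite psi0 subr0 /= addr0 -[h%:A]/(h * 1) mulr1.
rewrite -[leRHS]/(h^-1 * psi h) ler_pdivlMl//; apply: le_trans (psiK h).
rewrite mulrN mulNr lerN2 -(mulr_powRB1 (normr_ge0 h)) ?(lt_trans _ b1)//.
by rewrite mulrCA (gtr0_norm h0) ler_pM2l// -[X in X `^ _]gtr0_norm.
Unshelve. all: by end_near. Qed.

(** The vertex [x] makes the supremum nonnegative, hence a real number; over an empty [V] it would
    be minus infinity. *)
Lemma norm_sup_bound (R : realType) (V : choiceType) (f : V -> R) (r : R) (x : V) :
  (norm_sup f < r%:E)%E -> (forall x, 0 <= f x) ->
  [/\ forall x, 0 <= f x <= fine (norm_sup f), 0 <= fine (norm_sup f) &
      fine (norm_sup f) < r].
Proof.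
move=> fr f0.
have ub y : ((f y)%:E <= norm_sup f)%E.
  by rewrite -[f y]ger0_norm//; apply: ereal_sup_ubound; exists y.
have ns0 : (0 <= norm_sup f)%E by apply: le_trans (ub x); rewrite lee_fin.
have nsE : norm_sup f = (fine (norm_sup f))%:E.
  by rewrite fineK// ge0_fin_numE// (lt_trans fr)// ltry.
split; last by rewrite -lte_fin -nsE.
- by move=> y; rewrite f0/= -lee_fin -nsE.
- by rewrite -lee_fin -nsE.
Qed.

Theorem theorem1p2 (R : realType) (V : choiceType) (G : wgraph R V)
  (mu0 : R) (hmu0 : 0 < mu0) (hmu : forall x, mu0 <= vmeas G x)
  (p q : R) (hp : 2 <= p) (hq : 2 <= q)
  (h1 h2 : V -> R) (F : V -> R * R -> R) (e1 e2 : V -> R)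
  (he1 : inL G (p / (p - 1)) e1) (he2 : inL G (q / (q - 1)) e2)
  (e1_neq0 : exists x, e1 x != 0) (e2_neq0 : exists x, e2 x != 0)
  (h0 : R) (h0_gt0 : 0 < h0)
  (H1 : forall x, h0 <= h1 x /\ h0 <= h2 x)
  (x0 : V) (H2 : tends_to_infty G h1 x0 /\ tends_to_infty G h2 x0)
  (F0_C1 : C1 F)
  (a : R -> R) (a_cont : {within `[0, +oo[, continuous a})
  (a_ge0 : forall r, 0 <= r -> 0 <= a r)
  (b : V -> R) (b_ge0 : forall x, 0 <= b x) (b_L1 : inL G 1 b)
  (F0_bound : forall x s t,
    [/\ `|Fs F x s t| <= a (norm2 s t) * b x,
        `|Ft F x s t| <= a (norm2 s t) * b x &
        `|F x (s, t)| <= a (norm2 s t) * b x])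
  (F1_zero : forall x, F x (0, 0) = 0)
  (f1 f2 g1 g2 : V -> R)
  (fg_ge0 : forall x, [/\ 0 <= f1 x, 0 <= f2 x, 0 <= g1 x & 0 <= g2 x])
  (hg1 : inL G (p / (p - 1)) g1) (hg2 : inL G (q / (q - 1)) g2)
  (hf1 : (norm_sup f1 < (Num.min (h0 / 2) (q * h0 / (p * (q - 1))))%:E)%E)
  (hf2 : (norm_sup f2
          < (h0 - p * (q - 1) / q * fine (norm_sup f1))%:E)%E)
  (F1_s : forall x s t,
    `|Fs F x s t| <= f2 x * (`|t| `^ q + `|s| `^ (p - 1)) + g1 x)
  (F1_t : forall x s t,
    `|Ft F x s t| <=
      f1 x * (`|t| `^ (q - 1) + `|s| `^ ((q * p - p) / q)) + g2 x)
  (F2 :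
    (exists (beta1 : R) (K1 : V -> R),
       [/\ 1 < beta1,
           exists x1, 0 < K1 x1 /\ 0 < e1 x1 &
           forall s x, - K1 x * `|s| `^ beta1 <= F x (s, 0)])
    \/
    (exists (beta2 : R) (K2 : V -> R),
       [/\ 1 < beta2,
           exists x2, 0 < K2 x2 /\ 0 < e2 x2 &
           forall t x, - K2 x * `|t| `^ beta2 <= F x (0, t)])) :
  forall l1 l2 : R, 0 < l1 -> 0 < l2 ->
  exists u v : V -> R,
    [/\ is_solution G p q h1 h2 F e1 e2 l1 l2 u v,
        (u, v) <> (cst 0, cst 0),
        v = cst 0 ->
          (norm_sup u <=
           (mu0 `^ (- p^-1) *
            ((l1 * fine (normL G (p / (p - 1)) e1)
              + fine (normL G (p / (p - 1)) g1))
             / (h0 - fine (norm_sup f2))) `^ ((p - 1)^-1))%:E)%E &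
        u = cst 0 ->
          (norm_sup v <=
           (mu0 `^ (- q^-1) *
            ((l2 * fine (normL G (q / (q - 1)) e2)
              + fine (normL G (q / (q - 1)) g2))
             / (h0 - fine (norm_sup f1))) `^ ((q - 1)^-1))%:E)%E].
Proof.
move=> l1 l2 l1_gt0 l2_gt0.
have p0 : 0 < p by rewrite (lt_le_trans _ hp).
have q0 : 0 < q by rewrite (lt_le_trans _ hq).
have q1 : 1 < q by rewrite (lt_le_trans _ hq)// ltr1n.
have f1_ge0 x : 0 <= f1 x by have [] := fg_ge0 x.
have f2_ge0 x : 0 <= f2 x by have [] := fg_ge0 x.
have g1_ge0 x : 0 <= g1 x by have [] := fg_ge0 x.
have g2_ge0 x : 0 <= g2 x by have [] := fg_ge0 x.
have F_diff x (z : R * R) : differentiable (F x) z by have [] := F0_C1 x.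
have [f1m m1_ge0 m1_lt] := norm_sup_bound x0 hf1 f1_ge0.
have [f2m m2_ge0 m2_lt] := norm_sup_bound x0 hf2 f2_ge0.
set m1 := fine (norm_sup f1) in f1m m1_ge0 m1_lt m2_lt *.
set m2 := fine (norm_sup f2) in f2m m2_ge0 m2_lt *.
have {}m1_lt : m1 < h0 / 2.
  by apply: lt_le_trans m1_lt _; rewrite ge_min lexx.
have m1_lth : m1 < h0 by lra.
have m2_lth : m2 < h0.
  apply: lt_le_trans m2_lt _; rewrite gerBl mulr_ge0// divr_ge0 ?(ltW q0)//.
  by rewrite mulr_ge0 ?(ltW p0)// subr_ge0 ltW.
have h1_ge x : h0 <= h1 x by have [] := H1 x.
have h2_ge x : h0 <= h2 x by have [] := H1 x.
have [c [C [c_gt0 C_ge0 coercive]]] := potential_coercive hp hq F_diff F1_zero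
  f1m f2m g1_ge0 g2_ge0 F1_s F1_t e1 e2 h0_gt0 h1_ge h2_ge m1_lt m2_lt l1_gt0 l2_gt0.
set p' := p / (p - 1) in he1 hg1 coercive *.
set q' := q / (q - 1) in he2 hg2 coercive *.
pose I (r : R) (f : V -> R) := fine (integralV G (fun x => `|f x| `^ r)).
have Isum r f (S : {fset V}) : inL G r f -> \sum_(x <- S) `|f x| `^ r * vmeas G x <= I r f.
  move=> fL; rewrite /I.
  exact: (sum_le_integralV S (fun x => powR_ge0 `|f x| r) fL).
(* The integral of the error in [potential_coercive], finite by the integrability of the data,
   bounds the energy for all finite sets at once. *)
pose C0 := C * (I p' e1 + I p' g1 + I q' e2 + I q' g2).
have D_sum (S : {fset V}) : \sum_(x <- S) vmeas G x * (C * (`|e1 x| `^ p' + `|g1 x| `^ p' +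
    `|e2 x| `^ q' + `|g2 x| `^ q')) <= C0.
  apply: (@le_trans _ _ (C * (\sum_(x <- S) `|e1 x| `^ p' * vmeas G x +
    \sum_(x <- S) `|g1 x| `^ p' * vmeas G x +
    \sum_(x <- S) `|e2 x| `^ q' * vmeas G x +
    \sum_(x <- S) `|g2 x| `^ q' * vmeas G x))).
    rewrite -!big_split/= big_distrr/=; apply: ler_sum => x _.
    by rewrite le_eqVlt; apply/orP; left; apply/eqP; ring.
  by rewrite ler_wpM2l// !lerD// Isum.
have [u [v [EL E]]] := exists_solution hmu0 hmu hp hq h0_gt0 H1 F0_C1 F1_zero
  c_gt0 D_sum coercive.
have mu_ge0 x : 0 <= vmeas G x by rewrite ltW// vmeas_gt0.
have hu_ge0 (h w : V -> R) r x : (forall x, h0 <= h x) -> 0 <= h x * `|w x| `^ r.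
  by move=> hh; rewrite mulr_ge0 ?powR_ge0// (le_trans _ (hh x))// ltW.
(* Each component is controlled by dropping the nonnegative terms of the other one from the joint
   density. *)
have [uW uC] : inWh G p h1 u /\
    forall S : {fset V}, \sum_(x <- S) `|u x| `^ p * vmeas G x <= C0 / (c * h0).
  apply: (inWh_of_bounded hmu0 hmu hp h0_gt0 c_gt0 h1_ge E) => x.
  rewrite ler_wpM2l// lerD//.
    by rewrite lerDl divr_ge0 ?powR_ge0// ltW.
  by rewrite ler_pM2l// lerDl hu_ge0.
have [vW vC] : inWh G q h2 v /\
    forall S : {fset V}, \sum_(x <- S) `|v x| `^ q * vmeas G x <= C0 / (c * h0).
  apply: (inWh_of_bounded hmu0 hmu hq h0_gt0 c_gt0 h2_ge E) => x.
  rewrite ler_wpM2l// lerD//.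
    by rewrite lerDr divr_ge0 ?powR_ge0// ltW.
  by rewrite ler_pM2l// lerDr hu_ge0.
have normL_ge0 r f : 0 <= fine (normL G r f) by rewrite fine_ge0// poweR_ge0.
exists u, v; split.
- by split=> // x; have [] := EL x.
- move=> [u0 v0]; subst u v.
  have lap0 r x : pLaplacian G r (cst 0) x = 0.
    by rewrite /pLaplacian sum_adjE big1 ?mulr0// => y _; rewrite subrr mulr0.
  (* At the zero pair the first equation at [x] reads [0 = Fs F x 0 0 + l1 * e1 x], but the first
     summand is nonnegative and the second positive; the other alternative is symmetric. *)
  case: F2 => [[beta [K [b1 [x [Kx ex]] FK]]]|[beta [K [b1 [x [Kx ex]] FK]]]].
    have [+ _] := EL x; rewrite /EL1 lap0 mulr0 oppr0 addr0 => Fe.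
    have : 0 <= Fs F x 0 0.
      apply: (derive1_ge0_at_zero b1 Kx) => //; exact: derivable_Fl.
    have : 0 < l1 * e1 x by rewrite mulr_gt0.
    move: Fe => /=; lra.
  have [_] := EL x; rewrite /EL2 lap0 mulr0 oppr0 addr0 => Fe.
  have : 0 <= Ft F x 0 0.
    apply: (derive1_ge0_at_zero b1 Kx) => //; exact: derivable_Fr.
  have : 0 < l2 * e2 x by rewrite mulr_gt0.
  move: Fe => /=; lra.
- move=> v0; subst v; apply: ge_ereal_sup => _ [x _ <-]; rewrite lee_fin.
  (* With [v = 0] the growth condition leaves [m2 * |u|^(p-1)] plus [g1], so the right-hand side
     fits [sup_bound] with [l1 * |e1| + |g1|] in the role of [g]. *)
  apply: (@sup_bound _ _ G mu0 p hmu0 hmu hp u h1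
    (fun x => Fs F x (u x) 0 + l1 * e1 x) (fun x => l1 * `|e1 x| + `|g1 x|)
    h0 m2 _ _ uC h1_ge m2_lth) => //.
  + by move=> y; rewrite addr_ge0// mulr_ge0// ltW.
  + by rewrite addr_ge0// mulr_ge0// ltW.
  + by move=> y; have [] := EL y.
  + move=> y; apply: le_trans (ler_normD _ _) _.
    rewrite normrM (gtr0_norm l1_gt0) (addrC (l1 * _)) addrA lerD2r.
    apply: le_trans (F1_s y (u y) 0) _.
    rewrite normr0 powR0 ?gt_eqF// add0r (ger0_norm (g1_ge0 y)) lerD2r.
    by rewrite ler_wpM2r ?powR_ge0//; have /andP[] := f2m y.
  + move=> w S; rewrite mulrDl -mulrA.
    apply: (@le_trans _ _ (l1 * (\sum_(y <- S) `|e1 y| * `|w y| * vmeas G y) +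
      \sum_(y <- S) `|g1 y| * `|w y| * vmeas G y)).
      rewrite big_distrr -big_split/=; apply: ler_sum => y _.
      by rewrite le_eqVlt; apply/orP; left; apply/eqP; ring.
    by rewrite lerD// ?ler_pM2l// hoelder_normL.
- move=> u0; subst u; apply: ge_ereal_sup => _ [x _ <-]; rewrite lee_fin.
  apply: (@sup_bound _ _ G mu0 q hmu0 hmu hq v h2
    (fun x => Ft F x 0 (v x) + l2 * e2 x) (fun x => l2 * `|e2 x| + `|g2 x|)
    h0 m1 _ _ vC h2_ge m1_lth) => //.
  + by move=> y; rewrite addr_ge0// mulr_ge0// ltW.
  + by rewrite addr_ge0// mulr_ge0// ltW.
  + by move=> y; have [] := EL y.
  + move=> y; apply: le_trans (ler_normD _ _) _.
    rewrite normrM (gtr0_norm l2_gt0) (addrC (l2 * _)) addrA lerD2r.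
    apply: le_trans (F1_t y 0 (v y)) _.
    (* The mixed term vanishes at [u = 0] because its exponent [(q * p - p) / q] is positive; a zero
       exponent would give [1]. *)
    rewrite normr0 powR0 ?addr0; last first.
      by rewrite gt_eqF// divr_gt0// -{2}[p]mul1r -mulrBl mulr_gt0// subr_gt0.
    rewrite (ger0_norm (g2_ge0 y)) lerD2r.
    by rewrite ler_wpM2r ?powR_ge0//; have /andP[] := f1m y.
  + move=> w S; rewrite mulrDl -mulrA.
    apply: (@le_trans _ _ (l2 * (\sum_(y <- S) `|e2 y| * `|w y| * vmeas G y) +
      \sum_(y <- S) `|g2 y| * `|w y| * vmeas G y)).
      rewrite big_distrr -big_split/=; apply: ler_sum => y _.
      by rewrite le_eqVlt; apply/orP; left; apply/eqP; ring.
    by rewrite lerD// ?ler_pM2l// hoelder_normL.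
Qed.
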